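(* For $O_{\mathrm S},O_{\mathrm B},O_{\mathrm c}\in\{\sigma_1,\sigma_2,\sigma_3\}$ let $\mathcal L$ be the dynamical Lie algebra with Cartan decomposition $\mathcal L=\mathfrak k\oplus\mathfrak p$ and let $\mathfrak a\subset\mathfrak p$ be a Cartan subalgebra, as defined in the context. Then out of the $27$ possible choices of $(O_{\mathrm S},O_{\mathrm B},O_{\mathrm c})$, exactly $16$ have $\dim\mathfrak a=2$, namely those with $O_{\mathrm B}\in\{\sigma_1,\sigma_2\}$ and $(O_{\mathrm S},O_{\mathrm c})\neq(\sigma_3,\sigma_3)$; for the other $11$ choices $\dim\mathfrak a=1$. Moreover, exactly these 16 choices allow for purification of the qubit with a thermal ancilla: for every ancilla state $\rho_{\mathrm B}=\mathrm{diag}(p^{\mathrm e}_{\mathrm B},p^{\mathrm g}_{\mathrm B})$ with $p^{\mathrm e}_{\mathrm B},p^{\mathrm g}_{\mathrm B}\ge0$, $p^{\mathrm e}_{\mathrm B}+p^{\mathrm g}_{\mathrm B}=1$ and $p^{\mathrm e}_{\mathrm B}\neq p^{\mathrm g}_{\mathrm B}$, the connected Lie group generated by $\exp(\mathcal L)$ contains an element $U$ for which the map $X\mapsto\mathrm{tr}_{\mathrm B}\{U(X\otimes\rho_{\mathrm B})U^\dagger\}$ is non-unital if and only if $\dim\mathfrak a=2$.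
   Context: $\sigma_1,\sigma_2,\sigma_3$ are the Pauli matrices; the first tensor factor of $\mathbb C^2\otimes\mathbb C^2$ is the qubit S, the second the ancilla B; $\mathrm{tr}_{\mathrm B}$ is the partial trace over the second factor. The underlying Hamiltonian is $H(t)=\big(\tfrac{\omega_{\mathrm S}}2\sigma_3+\mathcal E(t)O_{\mathrm c}\big)\otimes\mathbb 1+\mathbb 1\otimes\tfrac{\omega_{\mathrm B}}2\sigma_3+J\,O_{\mathrm S}\otimes O_{\mathrm B}$, with control field $\mathcal E(t)$ acting on the qubit only. The dynamical Lie algebra $\mathcal L\subset\mathfrak{su}(4)$ is the real Lie algebra generated by the terms $i\sigma_3\otimes\mathbb 1$, $i\mathbb 1\otimes\sigma_3$, $iO_{\mathrm c}\otimes\mathbb 1$ and $iO_{\mathrm S}\otimes O_{\mathrm B}$. Its Cartan decomposition is $\mathcal L=\mathfrak k\oplus\mathfrak p$, where $\mathfrak k$ is the intersection of $\mathcal L$ with the span of the local operators $i\sigma_a\otimes\mathbb 1$, $i\mathbb 1\otimes\sigma_b$, and $\mathfrak p$ the intersection of $\mathcal L$ with the span of the non-local operators $i\sigma_a\otimes\sigma_b$ ($a,b\in\{1,2,3\}$). A Cartan subalgebra $\mathfrak a$ is a maximal Abelian subalgebra contained in $\mathfrak p$ (its dimension does not depend on the choice). A linear map $\mathcal D$ on $2\times2$ matrices is unital if $\mathcal D[\mathbb 1]=\mathbb 1$. *)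

(* Defs.v *)
From HB Require Import structures.
From mathcomp Require Import all_boot all_order all_algebra.
From mathcomp Require Import complex mxtens.
From mathcomp Require Import all_classical all_reals all_analysis.

Set Implicit Arguments.
Unset Strict Implicit.
Unset Printing Implicit Defensive.

Import Order.TTheory GRing.Theory Num.Theory.
Import numFieldNormedType.Exports.

Local Open Scope classical_set_scope.
Local Open Scope ring_scope.

(* Complex matrices are regarded as a real vector space: only real scalars are
   allowed in subspaces, spans, Lie subalgebras and dimensions. *)
Section RealLieAlgebras.
Variables (R : realType) (n : nat).
Implicit Types (V G : set 'M[R[i]]_n) (X Y : 'M[R[i]]_n).

Definition real_subspace V : Prop :=
  [/\ V 0,
      forall X Y, V X -> V Y -> V (X + Y)
    & forall (r : R) X, V X -> V (r%:C%C *: X)].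

Definition real_span G : set 'M[R[i]]_n := smallest real_subspace G.

Definition lie_bracket X Y : 'M[R[i]]_n := X *m Y - Y *m X.

Definition real_lie_subalgebra V : Prop :=
  real_subspace V /\ (forall X Y, V X -> V Y -> V (lie_bracket X Y)).

Definition lie_generated G : set 'M[R[i]]_n := smallest real_lie_subalgebra G.

Definition lie_abelian V : Prop :=
  forall X Y, V X -> V Y -> lie_bracket X Y = 0.

Definition has_real_dim V (d : nat) : Prop :=
  exists b : 'I_d -> 'M[R[i]]_n,
    (forall c : 'I_d -> R, \sum_(k < d) (c k)%:C%C *: b k = 0 ->
       forall k, c k = 0) /\
    V = [set X | exists c : 'I_d -> R, X = \sum_(k < d) (c k)%:C%C *: b k].

(* Limit for the entrywise (sup-norm) topology. *)
Definition expmx X : 'M[R[i]]_n :=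
  lim (series (fun k => (k`!%:R : R[i])^-1 *: X ^+ k) @ \oo).

Definition matrix_group (H : set 'M[R[i]]_n) : Prop :=
  [/\ H `<=` [set X | X \in unitmx],
      H 1%:M,
      forall X Y, H X -> H Y -> H (X *m Y)
    & forall X, H X -> H (invmx X)].

(* The abstract subgroup of GL_n generated by exp(V): for a Lie algebra V this
   is the underlying group of the connected Lie group with Lie algebra V. *)
Definition connected_lie_group V : set 'M[R[i]]_n :=
  smallest matrix_group (expmx @` V).

End RealLieAlgebras.

Section TwoQubits.
Variable R : realType.

Definition mx2 (a b c d : R[i]) : 'M[R[i]]_2 :=
  \matrix_(i, j) if i == ord0 then (if j == ord0 then a else b)
                 else (if j == ord0 then c else d).

Definition sigma1 : 'M[R[i]]_2 := mx2 0 1 1 0.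
Definition sigma2 : 'M[R[i]]_2 := mx2 0 (- 'i%C) 'i%C 0.
Definition sigma3 : 'M[R[i]]_2 := mx2 1 0 0 (- 1).

(* The index a = 0, 1, 2 stands for sigma_(a+1). *)
Definition pauli (a : 'I_3) : 'M[R[i]]_2 :=
  nth 0 [:: sigma1; sigma2; sigma3] a.

Definition dynamical_lie_algebra (OS OB Oc : 'M[R[i]]_2) :
    set 'M[R[i]]_(2 * 2) :=
  lie_generated
    [set X | [\/ X = 'i%C *: (sigma3 *t 1%:M), X = 'i%C *: (1%:M *t sigma3),
                 X = 'i%C *: (Oc *t 1%:M) | X = 'i%C *: (OS *t OB)]].

Definition local_operators : set 'M[R[i]]_(2 * 2) :=
  [set X | exists a, X = 'i%C *: (pauli a *t 1%:M) \/
                     X = 'i%C *: (1%:M *t pauli a)].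

Definition nonlocal_operators : set 'M[R[i]]_(2 * 2) :=
  [set X | exists a b, X = 'i%C *: (pauli a *t pauli b)].

Definition cartan_k (L : set 'M[R[i]]_(2 * 2)) : set 'M[R[i]]_(2 * 2) :=
  L `&` real_span local_operators.

Definition cartan_p (L : set 'M[R[i]]_(2 * 2)) : set 'M[R[i]]_(2 * 2) :=
  L `&` real_span nonlocal_operators.

Definition direct_sum_decomposition (L k p : set 'M[R[i]]_(2 * 2)) : Prop :=
  L = [set X + Y | X in k & Y in p] /\ k `&` p = [set 0].

Definition abelian_subalgebra_in (p a : set 'M[R[i]]_(2 * 2)) : Prop :=
  [/\ real_lie_subalgebra a, lie_abelian a & a `<=` p].

(* Maximality is among the Abelian subalgebras contained in p; a larger Abelian
   subalgebra of L that leaves p is allowed. *)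
Definition cartan_subalgebra (L a : set 'M[R[i]]_(2 * 2)) : Prop :=
  abelian_subalgebra_in (cartan_p L) a /\
  (forall b, abelian_subalgebra_in (cartan_p L) b -> a `<=` b -> b = a).

(* "dim a = d" for one, equivalently any, Cartan subalgebra a. Requiring both
   existence and the universal statement makes this independent of the choice
   of a and never vacuous. *)
Definition cartan_dim (L : set 'M[R[i]]_(2 * 2)) (d : nat) : Prop :=
  (exists a, cartan_subalgebra L a) /\
  (forall a, cartan_subalgebra L a -> has_real_dim a d).

Definition adjmx n (U : 'M[R[i]]_n) : 'M[R[i]]_n := map_mx conjc U^T.

Definition ptraceB (M : 'M[R[i]]_(2 * 2)) : 'M[R[i]]_2 :=
  \matrix_(i, j) \sum_(k < 2) M (mxtens_index (i, k)) (mxtens_index (j, k)).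

Definition ancilla_state (pe pg : R) : 'M[R[i]]_2 := mx2 pe%:C%C 0 0 pg%:C%C.

Definition qubit_map (U : 'M[R[i]]_(2 * 2)) (rhoB X : 'M[R[i]]_2) :
    'M[R[i]]_2 :=
  ptraceB (U *m (X *t rhoB) *m adjmx U).

Definition unital (D : 'M[R[i]]_2 -> 'M[R[i]]_2) : Prop := D 1%:M = 1%:M.

End TwoQubits.

(* Main.v *)
Require Import Defs.
From HB Require Import structures.
From mathcomp Require Import all_boot all_order all_algebra.
From mathcomp Require Import complex mxtens spectral.
From mathcomp Require Import all_classical all_reals all_analysis.
From mathcomp Require Import ring lra.

Set Implicit Arguments.
Unset Strict Implicit.
Unset Printing Implicit Defensive.

Import Order.TTheory GRing.Theory Num.Theory.
Import numFieldNormedType.Exports.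
Local Open Scope ring_scope.

(* All generators are i times a Pauli string sigma_a (x) sigma_b, and brackets
   of such strings are again real multiples of such strings, so L, k and p are
   spanned by explicit sets of strings.  For dim a = 2 the space p is identified
   with the real 3x2 (or 2x2) matrices, two matrices X and Y commuting iff
   X^T Y and X Y^T are symmetric.  The products X^T Y of an Abelian family
   commute with each other, so a single rotation of the two columns diagonalizes
   all of them; after it, all first columns are proportional, all second columns
   are proportional, and these two directions are orthogonal: the family lies in
   an Abelian plane.  In the remaining cases commuting elements of p are
   proportional.

   If dim a = 1, then L commutes either with 1 (x) sigma_3, so that U commutes
   with 1 (x) rho_B, or with sigma_3 (x) 1; in both cases the map is unital.
   If dim a = 2, then L contains i sigma_1 (x) sigma_1 and i sigma_2 (x) sigma_2,
   whose exponentials generate the iSWAP gate, and the map of this gate sends 1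
   to 2 rho_B. *)

(** * Exponential series of combinations of orthogonal idempotents *)

Section Exponential.
Local Open Scope classical_set_scope.
Variable R : realType.
Local Notation C := (Num.NumField.sort R[i]).

Lemma cvg_real_complex (u : nat -> R) (l : R) :
  u @ \oo --> l -> (fun n => (u n)%:C%C : C) @ \oo --> (l%:C%C : C).
Proof.
move=> ul; apply/cvgrPdist_lt => -[e f]; rewrite ltcE /= => /andP[/eqP -> e0].
move/cvgrPdist_lt: ul => /(_ _ e0); apply: filterS => n.
by rewrite -rmorphB /= normc_def /= expr0n addr0 sqrtr_sqr ltcR.
Qed.

Definition expi (t : R) : C := (cos t +i* sin t)%C.

(** Powers of i are real for even [k] and i times a real for odd [k], so each exponential term is
    one cosine or one sine term. *)
Lemma expi_coeff (t : R) (k : nat) :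
  (k`!%:R : C)^-1 * ('i%C * t%:C%C) ^+ k =
  (cos_coeff t k)%:C%C + 'i%C * (sin_coeff t k)%:C%C.
Proof.
rewrite exprMn -rmorphXn /= /cos_coeff /sin_coeff /=.
have i2 m : ('i%C : C) ^+ m.*2 = ((-1) ^+ m)%:C%C.
  by rewrite -mul2n exprM sqr_i rmorphXn /= rmorphN rmorph1.
have -> : (k`!%:R : C) = (k`!%:R)%:C%C by rewrite rmorph_nat.
rewrite -fmorphV /=.
case: (boolP (odd k)) => ok /=.
- have -> : ('i%C : C) ^+ k = 'i%C * ((-1) ^+ k.-1./2)%:C%C.
    by rewrite -i2 -exprS -[in LHS](odd_double_half k) ok add1n;
       congr (_ ^+ (_.*2).+1); rewrite -[in RHS](odd_double_half k) ok /= doubleK.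
  rewrite mul0r mul0r mul0r rmorph0 add0r mul1r !rmorphM /=; ring.
- have -> : ('i%C : C) ^+ k = ((-1) ^+ k./2)%:C%C.
    by rewrite -i2 -[in LHS](odd_double_half k) (negbTE ok).
  rewrite !mul0r rmorph0 mulr0 addr0 mul1r !rmorphM /=; ring.
Qed.

Lemma cvg_expi (t : R) :
  series (fun k => (k`!%:R : C)^-1 * ('i%C * t%:C%C) ^+ k) @ \oo --> expi t.
Proof.
rewrite (_ : series _ = fun n => (series (cos_coeff t) n)%:C%C +
                                 'i%C * (series (sin_coeff t) n)%:C%C); last first.
  apply/funext => n; rewrite /series /= !rmorph_sum /= mulr_sumr -big_split /=.
  by apply: eq_bigr => k _; rewrite expi_coeff.
have -> : expi t = (cos t)%:C%C + 'i%C * (sin t)%:C%C.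
  by rewrite /expi; apply/eqP; rewrite eq_complex /=
    !(mul0r, mul1r, mulr0, subrr, addr0, add0r, oppr0) !eqxx.
apply: cvgD; first apply: cvg_real_complex.
  by rewrite cos.unlock; exact: is_cvg_series_cos_coeff.
apply: cvgM; first exact: cvg_cst.
apply: cvg_real_complex.
by rewrite sin.unlock; exact: is_cvg_series_sin_coeff.
Qed.

(** Mixed products vanish, so powers act on the coefficients alone; completeness of the idempotents
    gives exponent 0. *)
Lemma expr_sum_idem (n m : nat) (d : 'I_m -> C) (E : 'I_m -> 'M[C]_n) (k : nat) :
  (forall i j, E i *m E j = if i == j then E i else 0) ->
  \sum_i E i = 1%:M ->
  (\sum_i d i *: E i) ^+ k = \sum_i d i ^+ k *: E i.
Proof.
move=> EE E1; elim: k => [|k IHk].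
  by rewrite expr0 -[LHS]E1; apply: eq_bigr => i _; rewrite expr0 scale1r.
rewrite exprS IHk [LHS]mulmx_suml; apply: eq_bigr => i _.
rewrite mulmx_sumr (bigD1 i) //= big1 => [|j /negPf ji].
  by rewrite addr0 -scalemxAl -scalemxAr EE eqxx scalerA exprS.
by rewrite -scalemxAl -scalemxAr EE eq_sym ji !scaler0.
Qed.

Lemma cvg_sum (V : normedModType C) (I : Type) (r : seq I) (f : I -> nat -> V)
    (l : I -> V) :
  (forall i, f i @ \oo --> l i) ->
  (fun N => \sum_(i <- r) f i N) @ \oo --> \sum_(i <- r) l i.
Proof.
move=> fl; elim: r => [|i r IHr].
  rewrite big_nil (_ : (fun _ => _) = fun=> 0); first exact: cvg_cst.
  by apply/funext => N; rewrite big_nil.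
rewrite big_cons (_ : (fun _ => _) = fun N => f i N + \sum_(j <- r) f j N).
  exact: cvgD.
by apply/funext => N; rewrite big_cons.
Qed.

(** Exchanging the finite sums turns the matrix series into one scalar series per idempotent, and
    Euler's formula gives each limit. *)
Lemma expmx_sum_idem (n m : nat) (t : 'I_m -> R) (E : 'I_m -> 'M[C]_n) :
  (forall i j, E i *m E j = if i == j then E i else 0) ->
  \sum_i E i = 1%:M ->
  expmx (\sum_i ('i%C * (t i)%:C%C) *: E i) = \sum_i expi (t i) *: E i.
Proof.
move=> EE E1; rewrite /expmx; apply: (cvg_lim (@norm_hausdorff _ _)).
rewrite (_ : series _ = fun N => \sum_i
  series (fun k => (k`!%:R : C)^-1 * ('i%C * (t i)%:C%C) ^+ k) N *: E i); last first.
  apply/funext => N; rewrite /series /=.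
  under [RHS]eq_bigr do rewrite scaler_suml.
  rewrite exchange_big /=; apply: eq_bigr => k _.
  rewrite expr_sum_idem // scaler_sumr; apply: eq_bigr => i _.
  by rewrite scalerA.
apply: cvg_sum => i; apply: cvgZr_tmp; exact: cvg_expi.
Qed.

End Exponential.

(** * Exponentials of anti-Hermitian matrices through the spectral theorem *)

Section UnitaryExponential.
Local Open Scope classical_set_scope.
Variable R : realType.
Local Notation C := R[i].

Lemma adjmxM n (A B : 'M[C]_n) : adjmx (A *m B) = adjmx B *m adjmx A.
Proof. by rewrite /adjmx trmx_mul map_mxM. Qed.

Lemma adjmxK n (A : 'M[C]_n) : adjmx (adjmx A) = A.
Proof. by apply/matrixP => i j; rewrite !mxE conjcK. Qed.

Lemma expi_unit (t : R) : conjc (expi t) * expi t = 1.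
Proof.
apply/eqP; rewrite eq_complex /=; apply/andP; split; apply/eqP; last by ring.
by rewrite -(cos2Dsin2 t); ring.
Qed.

(** Multiplied by -i, [X] becomes Hermitian, so it is unitarily diagonalizable with real eigenvalues
    [t j]; those of [X] are i times these. *)
Lemma antihermitian_spectral n (X : 'M[C]_n) : adjmx X = - X ->
  exists (P : 'M[C]_n) (t : 'I_n -> R),
    [/\ P \in unitmx, invmx P = adjmx P &
      X = invmx P *m diag_mx (\row_j ('i%C * (t j)%:C%C)) *m P].
Proof.
move=> Xanti; pose H := - 'i%C *: X.
have Hh : H \is hermsymmx.
  apply/is_hermitianmxP; rewrite expr0 scale1r.
  have -> : map_mx Num.conj H^T = adjmx H by [].
  have -> : adjmx H = 'i%C *: adjmx X.
    apply/matrixP => i j; rewrite !mxE rmorphM rmorphN /=; congr (_ * _).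
    by apply/eqP; rewrite eq_complex /= !(oppr0, opprK) !eqxx.
  by rewrite Xanti scalerN -scaleNr.
have [P [d [PU PV HE dr]]] : exists (P : 'M[C]_n) (d : 'rV[C]_n),
    [/\ P \in unitmx, invmx P = adjmx P, H = invmx P *m diag_mx d *m P &
      forall j, (complex.Re (d 0 j))%:C%C = d 0 j].
  exists (spectralmx H), (spectral_diag H); split.
  - exact/unitarymx_unit/spectral_unitarymx.
  - exact/invmx_unitary/spectral_unitarymx.
  - exact/orthomx_spectralP/hermitian_normalmx.
  - move=> j; apply: RRe_real.
    by move/mxOverP: (hermitian_spectral_diag_real Hh); apply.
exists P, (fun j => complex.Re (d 0 j)); split; [exact: PU | exact: PV |].
have -> : X = 'i%C *: H by rewrite /H scalerA mulrN -expr2 sqr_i opprK scale1r.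
rewrite HE (scalemxAl 'i%C (invmx P *m diag_mx d) P) (scalemxAr 'i%C).
apply: (congr1 (fun M => invmx P *m M *m P)).
apply/matrixP => i j; rewrite !mxE; case: eqP => _; last by rewrite !mulr0n mulr0.
by rewrite !mulr1n dr.
Qed.

Lemma expmx_diag n (P : 'M[C]_n) (t : 'I_n -> R) : P \in unitmx ->
  expmx (invmx P *m diag_mx (\row_j ('i%C * (t j)%:C%C)) *m P) =
  invmx P *m diag_mx (\row_j expi (t j)) *m P.
Proof.
move=> PU; pose E i := invmx P *m delta_mx i i *m P.
have dE (d : 'I_n -> C) :
    invmx P *m diag_mx (\row_j d j) *m P = \sum_i d i *: E i.
  rewrite diag_mx_sum_delta mulmx_sumr mulmx_suml; apply: eq_bigr => i _.
  by rewrite mxE -scalemxAr -scalemxAl.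
rewrite !dE; apply: expmx_sum_idem => [i j|].
  rewrite /E !mulmxA mulmxK // -(mulmxA _ (delta_mx i i) (delta_mx j j)).
  case: eqP => [<-|/eqP ij]; first by rewrite mul_delta_mx.
  by rewrite mul_delta_mx_0 // mulmx0 mul0mx.
(* With all coefficients equal to 1, the decomposition [dE] expresses the completeness of the
   idempotents. *)
have := dE (fun=> 1); under eq_bigr do rewrite scale1r.
move=> <-; have -> : \row_(_ < n) (1 : C) = const_mx 1 by apply/rowP => j; rewrite !mxE.
by rewrite diag_const_mx mulmx1 mulVmx.
Qed.

Lemma expmx_unitary n (X : 'M[C]_n) : adjmx X = - X ->
  expmx X *m adjmx (expmx X) = 1%:M.
Proof.
move=> /antihermitian_spectral [P [t [PU PV ->]]]; rewrite (expmx_diag _ PU).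
apply: mulmx1C; rewrite !adjmxM PV adjmxK -PV !mulmxA mulmxK //.
rewrite -(mulmxA (invmx P)); set D := (X in invmx P *m X *m P).
suff -> : D = 1%:M by rewrite mulmx1 mulVmx.
apply/matrixP => i j; rewrite /D mul_mx_diag !mxE (eq_sym i).
case: (j == i); first by rewrite !mulr1n expi_unit.
by rewrite !mulr0n conjc0 mul0r.
Qed.

Lemma conjmx_comm (F : fieldType) n (P A B : 'M[F]_n) : P \in unitmx ->
  (invmx P *m A *m P) *m (invmx P *m B *m P) =
  (invmx P *m B *m P) *m (invmx P *m A *m P) <-> A *m B = B *m A.
Proof.
move=> PU; have cjM (X Y : 'M[F]_n) :
    invmx P *m X *m P *m (invmx P *m Y *m P) = invmx P *m (X *m Y) *m P.
  by rewrite !mulmxA mulmxK.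
have cjK (X : 'M[F]_n) : P *m (invmx P *m X *m P) *m invmx P = X.
  by rewrite !mulmxA mulmxV // mul1mx mulmxK.
rewrite !cjM; split=> [|-> //]; move/(congr1 (fun X => P *m X *m invmx P)).
by rewrite !cjK.
Qed.

(** In an eigenbasis of [X], a commuting matrix has zero entries between distinct eigenvalues, and
    equal eigenvalues have equal exponentials. *)
Lemma expmx_comm n (X Z : 'M[C]_n) : adjmx X = - X ->
  X *m Z = Z *m X -> expmx X *m Z = Z *m expmx X.
Proof.
move=> /antihermitian_spectral [P [t [PU PV ->]]]; rewrite (expmx_diag _ PU).
pose W := P *m Z *m invmx P.
have -> : Z = invmx P *m W *m P by rewrite /W !mulmxA mulVmx // mul1mx mulmxKV.
clearbody W.
move/(conjmx_comm _ _ PU)/matrixP => dW; apply/(conjmx_comm _ _ PU).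
apply/matrixP => i j; have := dW i j.
rewrite !(mul_diag_mx, mul_mx_diag) !mxE ![W i j * _]mulrC.
have [-> _|W0 /(mulIf W0)] := eqVneq (W i j) 0; first by rewrite !mulr0.
move=> /mulfI; rewrite eq_complex /= oner_eq0 andbF => /(_ isT) [->] //.
Qed.

End UnitaryExponential.

(** * Pauli strings, their products and their Lie brackets *)

Section PauliStrings.
Local Open Scope classical_set_scope.
Variable R : realType.
Local Notation C := R[i].

Lemma mx2_mul (a b c d a' b' c' d' : C) :
  mx2 a b c d *m mx2 a' b' c' d' =
  mx2 (a * a' + b * c') (a * b' + b * d') (c * a' + d * c') (c * b' + d * d').
Proof.
apply/matrixP => i j; rewrite !mxE !big_ord_recl big_ord0 !mxE /= addr0.
by case: (i == ord0); case: (j == ord0).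
Qed.

Lemma mx2_scale (k a b c d : C) :
  k *: mx2 a b c d = mx2 (k * a) (k * b) (k * c) (k * d).
Proof.
by apply/matrixP => i j; rewrite !mxE; case: (i == ord0); case: (j == ord0).
Qed.

Lemma mx2_1 : 1%:M = mx2 1 0 0 1 :> 'M[C]_2.
Proof. by apply/matrixP => -[[|[|]]] //= ? [[|[|]]] //= ?; rewrite !mxE. Qed.

Lemma mx2_tr (a b c d : C) : \tr (mx2 a b c d) = a + d.
Proof. by rewrite /mxtrace !big_ord_recl big_ord0 !mxE addr0. Qed.

(* Binary symplectic encoding: the bits (x, z) stand for sigma_1^x sigma_3^z up
   to a phase, so that products of Pauli matrices become sums of bits. *)
Definition pauli_bits : Type := (bool * bool)%type.
HB.instance Definition _ := Finite.on pauli_bits.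

Definition bits_add (a b : pauli_bits) : pauli_bits := (a.1 (+) b.1, a.2 (+) b.2).

(** The symplectic form on bits; it is true exactly when the two Pauli matrices anticommute. *)
Definition bits_anti (a b : pauli_bits) : bool := (a.1 && b.2) (+) (a.2 && b.1).

(* The cyclic order sigma_1 -> sigma_2 -> sigma_3 -> sigma_1. *)
Definition bits_cyc (a b : pauli_bits) : bool :=
  (b.1 == a.1 (+) a.2) && (b.2 == a.1).

Definition bits_phase (a b : pauli_bits) : C :=
  if bits_anti a b then if bits_cyc a b then 'i%C else - 'i%C else 1.

Definition pauli_of (a : pauli_bits) : 'M[C]_2 :=
  if a.1 then if a.2 then sigma2 R else sigma1 R
  else if a.2 then sigma3 R else 1%:M.

Lemma pauli_of_mul a b :
  pauli_of a *m pauli_of b = bits_phase a b *: pauli_of (bits_add a b).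
Proof.
have i2 : 'i%C * 'i%C = -1 :> C by rewrite -expr2 sqr_i.
case: a b => [[] []] [[] []]; rewrite /pauli_of /bits_phase /bits_anti /bits_cyc /=;
  rewrite ?mul1mx ?mulmx1 ?scale1r ?mx2_1 ?mx2_mul ?mx2_scale //;
  by congr mx2; rewrite ?mulrN ?mulNr ?i2; ring.
Qed.

Lemma pauli_of_tr a : \tr (pauli_of a) = if a == (false, false) then 2 else 0.
Proof.
by case: a => [[] []]; rewrite /pauli_of /= ?mx2_1 mx2_tr ?addr0 ?subrr.
Qed.

Definition string : Type := (pauli_bits * pauli_bits)%type.
HB.instance Definition _ := Finite.on string.

Definition string_add (x y : string) : string :=
  (bits_add x.1 y.1, bits_add x.2 y.2).

(** Two strings anticommute exactly when one, but not both, of the tensor factors anticommutes. *)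
Definition string_anti (x y : string) : bool :=
  bits_anti x.1 y.1 (+) bits_anti x.2 y.2.

Definition string_mx (x : string) : 'M[C]_(2 * 2) := pauli_of x.1 *t pauli_of x.2.

Definition istring (x : string) : 'M[C]_(2 * 2) := 'i%C *: string_mx x.

(** The structure constant of the bracket of two strings. If they anticommute, one factor has phase
    1 and the other phase i or -i; the prefactor i times i then makes the cyclic order count as
    -2. *)
Definition string_sign (x y : string) : R :=
  if string_anti x y then
    if if bits_anti x.1 y.1 then bits_cyc x.1 y.1 else bits_cyc x.2 y.2
    then -2 else 2
  else 0.

Lemma tensmxZl m n p q (k : C) (A : 'M[C]_(m, n)) (B : 'M[C]_(p, q)) :
  (k *: A) *t B = k *: (A *t B).
Proof. by apply/matrixP => i j; rewrite !mxE mulrA. Qed.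

Lemma tensmxZr m n p q (k : C) (A : 'M[C]_(m, n)) (B : 'M[C]_(p, q)) :
  A *t (k *: B) = k *: (A *t B).
Proof. by apply/matrixP => i j; rewrite !mxE mulrCA. Qed.

Lemma tensmx_tr m n (A : 'M[C]_m) (B : 'M[C]_n) : \tr (A *t B) = \tr A * \tr B.
Proof. by rewrite /mxtrace mulr_sum; apply: eq_bigr => i _; rewrite mxE. Qed.

Lemma string_mul x y : string_mx x *m string_mx y =
  (bits_phase x.1 y.1 * bits_phase x.2 y.2) *: string_mx (string_add x y).
Proof.
by rewrite /string_mx tensmx_mul !pauli_of_mul tensmxZl tensmxZr scalerA.
Qed.

Lemma bits_addC a b : bits_add a b = bits_add b a.
Proof. by rewrite /bits_add addbC [a.2 (+) _]addbC. Qed.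

Lemma string_addC x y : string_add x y = string_add y x.
Proof. by rewrite /string_add bits_addC [bits_add x.2 _]bits_addC. Qed.

Lemma string_addK x y : string_add x (string_add x y) = y.
Proof. by case: x y => [[[] []] [[] []]] [[[] []] [[] []]]. Qed.

Lemma bits_phaseC a b : bits_phase b a =
  if bits_anti a b then - bits_phase a b else bits_phase a b.
Proof.
by case: a b => [[] []] [[] []]; rewrite /bits_phase /= ?opprK.
Qed.

Lemma lie_bracketZ n (k l : C) (X Y : 'M[C]_n) :
  lie_bracket (k *: X) (l *: Y) = (k * l) *: lie_bracket X Y.
Proof.
rewrite /lie_bracket -(scalemxAl k) -(scalemxAr l) -(scalemxAl l) -(scalemxAr k).
by rewrite !scalerA [l * k]mulrC -scalerBr.
Qed.

Lemma lie_bracket_istring x y : lie_bracket (istring x) (istring y) =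
  (string_sign x y)%:C%C *: istring (string_add x y).
Proof.
have i2 : 'i%C * 'i%C = -1 :> C by rewrite -expr2 sqr_i.
rewrite /istring lie_bracketZ /lie_bracket !string_mul [string_add y x]string_addC.
rewrite -scalerBl !scalerA; congr (_ *: _).
rewrite [bits_phase y.1 _]bits_phaseC [bits_phase y.2 _]bits_phaseC i2.
rewrite /string_sign /string_anti /bits_phase.
move: (bits_anti x.1 y.1) (bits_anti x.2 y.2) => [] [] /=;
  move: (bits_cyc x.1 y.1) (bits_cyc x.2 y.2) => [] [] /=;
  rewrite ?rmorphN ?rmorph0 ?rmorph_nat; ring: i2.
Qed.

Lemma string_mx_tr x : \tr (string_mx x) = if x == ((false, false), (false, false)) then 4 else 0.
Proof.
rewrite /string_mx tensmx_tr !pauli_of_tr.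
by case: x => [[[] []] [[] []]] /=; rewrite ?mulr0 ?mul0r // -natrM.
Qed.

Definition combo (c : string -> R) : 'M[C]_(2 * 2) :=
  \sum_x (c x)%:C%C *: istring x.

(** Strings are orthogonal for the trace form, since only the identity string has nonzero trace;
    hence a trace reads off each coefficient. *)
Lemma combo_coef (c : string -> R) (y : string) :
  \tr (string_mx y *m combo c) = 'i%C * 4 * (c y)%:C%C.
Proof.
rewrite /combo mulmx_sumr raddf_sum /= (bigD1 y) //= big1 => [|x xy].
  rewrite addr0 -!scalemxAr !mxtraceZ string_mul mxtraceZ string_mx_tr.
  have -> : string_add y y == ((false, false), (false, false)).
    by case: y => [[[] []] [[] []]].
  have -> : bits_phase y.1 y.1 = 1 by case: y => [[[] []] [[] []]].
  have -> : bits_phase y.2 y.2 = 1 by case: y => [[[] []] [[] []]].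
  ring.
rewrite -!scalemxAr !mxtraceZ string_mul mxtraceZ string_mx_tr.
suff /negPf -> : string_add y x != ((false, false), (false, false)) by rewrite !mulr0.
apply: contra xy => /eqP yx; apply/eqP.
by rewrite -(string_addK y x) yx; case: (y) => [[[] []] [[] []]].
Qed.

Lemma combo_inj (c d : string -> R) : combo c = combo d -> c =1 d.
Proof.
move=> cd y; have := combo_coef c y; rewrite cd combo_coef => /mulfI E.
have /E [->] // : 'i%C * 4 != 0 :> C.
by rewrite mulf_neq0 ?pnatr_eq0 // eq_complex /= oner_eq0 andbF.
Qed.

Lemma comboD c d : combo c + combo d = combo (fun x => c x + d x).
Proof.
rewrite /combo -big_split; apply: eq_bigr => x _.
by rewrite rmorphD scalerDl.
Qed.

Lemma comboZ (k : R) c : k%:C%C *: combo c = combo (fun x => k * c x).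
Proof.
by rewrite /combo scaler_sumr; apply: eq_bigr => x _; rewrite rmorphM scalerA.
Qed.

Lemma combo0 : combo (fun=> 0) = 0.
Proof. by rewrite /combo big1 // => x _; rewrite scale0r. Qed.

Lemma combo1 x : istring x = combo (fun y => (y == x)%:R).
Proof.
rewrite /combo (bigD1 x) //= eqxx scale1r big1 ?addr0 // => y /negPf ->.
by rewrite scale0r.
Qed.

Lemma eq_combo c d : c =1 d -> combo c = combo d.
Proof. by move=> cd; apply: eq_bigr => x _; rewrite cd. Qed.

(** The bracket of strings [x] and [y] lies along [z] only for [y = string_add x z], so a single sum
    over [x] collects the coefficient of [z]. *)
Definition bracket_coef (c d : string -> R) (z : string) : R :=
  \sum_x c x * d (string_add x z) * string_sign x (string_add x z).

Lemma lie_bracket_combo c d :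
  lie_bracket (combo c) (combo d) = combo (bracket_coef c d).
Proof.
have -> : lie_bracket (combo c) (combo d) =
    \sum_x \sum_y (c x * d y)%:C%C *: lie_bracket (istring x) (istring y).
  rewrite /lie_bracket /combo !mulmx_suml.
  under eq_bigr do rewrite mulmx_sumr.
  under [X in _ - X]eq_bigr do rewrite mulmx_sumr.
  rewrite [X in _ - X]exchange_big /= -sumrB; apply: eq_bigr => x _.
  rewrite -sumrB; apply: eq_bigr => y _.
  by rewrite rmorphM -lie_bracketZ.
rewrite /combo /bracket_coef; under [RHS]eq_bigr do rewrite rmorph_sum scaler_suml.
rewrite [RHS]exchange_big /=; apply: eq_bigr => x _.
rewrite [RHS](reindex_inj (can_inj (string_addK x))) /=; apply: eq_bigr => y _.
by rewrite lie_bracket_istring string_addK scalerA -rmorphM.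
Qed.

End PauliStrings.

(** * Dimension of real subspaces of complex matrices *)

Section RealDimension.
Local Open Scope classical_set_scope.
Variables (R : realType) (n : nat).
Local Notation C := R[i].
Implicit Types V W : set 'M[C]_n.

Definition real_combos (d : nat) (b : 'I_d -> 'M[C]_n) : set 'M[C]_n :=
  [set X | exists c : 'I_d -> R, X = \sum_(k < d) (c k)%:C%C *: b k].

Lemma real_subspace_sum V (I : finType) (F : I -> 'M[C]_n) :
  real_subspace V -> (forall i, V (F i)) -> V (\sum_i F i).
Proof. by move=> [V0 VD _] VF; elim/big_rec: _ => // i X _; exact: VD. Qed.

Lemma real_combos_subspace d (b : 'I_d -> 'M[C]_n) : real_subspace (real_combos b).
Proof.
split.
- by exists (fun=> 0); rewrite big1 // => k _; rewrite scale0r.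
- move=> _ _ [c ->] [c' ->]; exists (fun k => c k + c' k); rewrite -big_split.
  by apply: eq_bigr => k _; rewrite rmorphD scalerDl.
- move=> r _ [c ->]; exists (fun k => r * c k); rewrite scaler_sumr.
  by apply: eq_bigr => k _; rewrite rmorphM scalerA.
Qed.

Lemma real_combos_mem d (b : 'I_d -> 'M[C]_n) k : real_combos b (b k).
Proof.
exists (fun j => (j == k)%:R); rewrite (bigD1 k) //= eqxx scale1r.
by rewrite big1 ?addr0 // => j /negPf ->; rewrite scale0r.
Qed.

Lemma lie_bracket_sum (I J : finType) (F : I -> 'M[C]_n) (G : J -> 'M[C]_n) :
  lie_bracket (\sum_i F i) (\sum_j G j) = \sum_i \sum_j lie_bracket (F i) (G j).
Proof.
rewrite /lie_bracket !mulmx_suml.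
under eq_bigr do rewrite mulmx_sumr.
under [X in _ - X]eq_bigr do rewrite mulmx_sumr.
rewrite [X in _ - X]exchange_big /= -sumrB; apply: eq_bigr => i _.
by rewrite -sumrB.
Qed.

Lemma real_combos_commute d (b : 'I_d -> 'M[C]_n) :
  (forall j k, lie_bracket (b j) (b k) = 0) -> lie_abelian (real_combos b).
Proof.
move=> b0 _ _ [c ->] [c' ->]; rewrite lie_bracket_sum big1 // => j _.
by rewrite big1 // => k _; rewrite lie_bracketZ b0 scaler0.
Qed.

(** The coordinates of a basis of [V] in a basis of [W] form a matrix with independent rows, which
    bounds [d] by [d']. *)
Lemma has_real_dim_sub V W d d' : has_real_dim V d -> has_real_dim W d' ->
  V `<=` W -> (d <= d')%N /\ (d = d' -> V = W).
Proof.
move=> [b [bfree VE]] [b' [b'free WE]] VW.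
have /choice[M bM] : forall k, exists c : 'I_d' -> R,
    b k = \sum_j (c j)%:C%C *: b' j.
  by move=> k; have := VW (b k); rewrite VE WE; apply; exact: real_combos_mem.
pose A := \matrix_(k < d, j < d') M k j.
have combM (c : 'I_d -> R) : \sum_k (c k)%:C%C *: b k =
    \sum_j ((\row_k c k *m A) 0 j)%:C%C *: b' j.
  under eq_bigr do rewrite bM scaler_sumr.
  rewrite exchange_big /=; apply: eq_bigr => j _.
  rewrite !mxE rmorph_sum scaler_suml; apply: eq_bigr => k _.
  by rewrite !mxE scalerA rmorphM.
have Afree : row_free A.
  apply: inj_row_free => v vA; apply/rowP => k.
  rewrite mxE; apply: (bfree (v 0)); rewrite combM big1 // => j _.
  by rewrite (_ : \row__ _ = v) ?vA ?mxE ?scale0r //; apply/rowP => i; rewrite mxE.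
have le : (d <= d')%N by rewrite -(eqP Afree) rank_leq_col.
(* For equal dimensions the coordinate matrix is square, hence invertible, and its inverse expresses
   all of [W] in the basis of [V]. *)
split=> // dd; move: b' b'free WE M bM A combM Afree {le}; rewrite -{}dd.
move=> b' b'free WE M bM A combM Afree.
apply/seteqP; split=> // X; rewrite WE => -[c ->]; rewrite VE.
exists (fun k => (\row_j c j *m invmx A) 0 k); rewrite combM.
have -> : \row_k (\row_j c j *m invmx A) 0 k = \row_j c j *m invmx A.
  by apply/rowP => k; rewrite mxE.
rewrite mulmxKV -?row_free_unit //.
by apply: eq_bigr => j _; rewrite mxE.
Qed.

Lemma has_real_dim_inj V d d' : has_real_dim V d -> has_real_dim V d' -> d = d'.
Proof.
move=> Vd Vd'; apply/eqP; rewrite eqn_leq.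
by rewrite (has_real_dim_sub Vd Vd' (fun=> id)).1 (has_real_dim_sub Vd' Vd (fun=> id)).1.
Qed.

End RealDimension.

(** * Reduction of the Cartan dimension to a covering property *)

Section CartanDimension.
Local Open Scope classical_set_scope.
Variable R : realType.
Implicit Types L : set 'M[R[i]]_(2 * 2).

(** If every Abelian subalgebra in p lies in one of dimension [d], a maximal one equals its cover.
    Conversely a cover of the zero algebra is maximal: anything larger lies in another cover of the
    same dimension, hence coincides with it. *)
Lemma cartan_dim_cover L d : real_subspace (cartan_p L) ->
  (forall a, abelian_subalgebra_in (cartan_p L) a ->
     exists b, [/\ abelian_subalgebra_in (cartan_p L) b, a `<=` b &
                   has_real_dim b d]) ->
  cartan_dim L d.
Proof.
move=> [p0 _ _] cover; split.
  have ab0 : abelian_subalgebra_in (cartan_p L) [set 0].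
    split=> [|_ _ -> ->|_ -> //]; last by rewrite /lie_bracket !mulmx0 subrr.
    split; first split=> //.
    - by move=> _ _ -> ->; rewrite addr0.
    - by move=> r _ ->; rewrite scaler0.
    by move=> _ _ -> ->; rewrite /lie_bracket !mulmx0 subrr.
  have [b [bab _ bd]] := cover _ ab0; exists b; split=> // b' b'ab bb'.
  have [b'' [_ b'b'' b''d]] := cover _ b'ab.
  have bb'' := (has_real_dim_sub bd b''d (subset_trans bb' b'b'')).2 erefl.
  by apply/seteqP; split=> //; rewrite bb''.
move=> a [aab amax]; have [b [bab ab bd]] := cover _ aab.
by rewrite -(amax _ bab ab).
Qed.

Lemma cartan_dim_inj L d d' : cartan_dim L d -> cartan_dim L d' -> d = d'.
Proof.
by move=> [[a aC] ad] [_ ad']; exact: has_real_dim_inj (ad _ aC) (ad' _ aC).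
Qed.

End CartanDimension.

(** * Real spans of sets of strings and the Lie algebras they generate *)

Section StringSpans.
Local Open Scope classical_set_scope.
Variable R : realType.
Implicit Types S T : pred string.

Definition string_span S : set 'M[R[i]]_(2 * 2) :=
  [set X | exists2 c, (forall x, ~~ S x -> c x = 0) & X = combo c].

Definition istrings S : set 'M[R[i]]_(2 * 2) :=
  [set X | exists2 x, S x & X = istring R x].

Lemma string_span_mem S x : S x -> string_span S (istring R x).
Proof.
move=> Sx; exists (fun y => (y == x)%:R); last exact: combo1.
by move=> y Sy; case: eqP Sy => // ->; rewrite Sx.
Qed.

Lemma string_span_subspace S : real_subspace (string_span S).
Proof.
split.
- by exists (fun=> 0); rewrite // combo0.
- move=> _ _ [c cS ->] [d dS ->]; exists (fun x => c x + d x); last exact: comboD.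
  by move=> x Sx; rewrite cS // dS // addr0.
- move=> r _ [c cS ->]; exists (fun x => r * c x); last exact: comboZ.
  by move=> x Sx; rewrite cS // mulr0.
Qed.

Lemma string_span_sub S V : real_subspace V ->
  (forall x, S x -> V (istring R x)) -> string_span S `<=` V.
Proof.
move=> Vs VS _ [c cS ->]; apply: real_subspace_sum => // x.
have [V0 _ VZ] := Vs.
by case: (boolP (S x)) => [/VS /VZ //|/cS ->]; rewrite scale0r.
Qed.

Lemma real_span_istrings S : real_span (istrings S) = string_span S.
Proof.
apply/seteqP; split.
  apply: smallest_sub; first exact: string_span_subspace.
  by move=> _ [x Sx ->]; exact: string_span_mem.
move=> X XS V [Vs VS]; move: X XS; apply: string_span_sub => // x Sx.
by apply: VS; exists x.
Qed.

(** Uniqueness of coefficients makes supports intersect along with the spans. *)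
Lemma string_spanI S T :
  string_span S `&` string_span T = string_span (predI S T).
Proof.
apply/seteqP; split=> X.
  move=> [[c cS ->] [d dT /combo_inj cd]]; exists c => // x /=.
  by rewrite negb_and => /orP[/cS //|/dT]; rewrite cd.
move=> [c cST ->]; split; exists c => // x nx; apply: cST => /=;
  by rewrite (negPf nx) ?andbF.
Qed.

(** Only anticommuting pairs are tested, because commuting strings have zero bracket. *)
Definition string_closed S :=
  forall x y, S x -> S y -> string_anti x y -> S (string_add x y).

Lemma string_span_lie S : string_closed S -> real_lie_subalgebra (string_span S).
Proof.
move=> Sc; split=> [|_ _ [c cS ->] [d dS ->]]; first exact: string_span_subspace.
exists (bracket_coef c d); last exact: lie_bracket_combo.
move=> z Sz; apply: big1 => x _; rewrite /string_sign.
case: (boolP (S x)) => [Sx|/cS ->]; last by rewrite !mul0r.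
case: (boolP (S (string_add x z))) => [Sxz|/dS ->]; last by rewrite mulr0 mul0r.
case: ifP => [/(Sc _ _ Sx Sxz)|_]; last by rewrite mulr0.
by rewrite string_addK (negPf Sz).
Qed.

(** The last hypothesis is an induction principle: every string of [S] is reached from [G] by sums
    of anticommuting strings, that is, by nonzero brackets. *)
Lemma lie_generated_istrings (G S : pred string) :
  (forall x, G x -> S x) -> string_closed S ->
  (forall P : string -> Prop, (forall x, G x -> P x) ->
     (forall x y, P x -> P y -> string_anti x y -> P (string_add x y)) ->
     forall x, S x -> P x) ->
  lie_generated (istrings G) = string_span S.
Proof.
move=> GS Sc SG; apply/seteqP; split.
  apply: smallest_sub; first exact: string_span_lie.
  by move=> _ [x /GS Sx ->]; exact: string_span_mem.
move=> X XS V [[Vs Vb] VG]; move: X XS; apply: string_span_sub => // x Sx.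
apply: (SG (fun x => V (istring R x))) Sx => [{}x Gx|{}x y Vx Vy xy].
  by apply: VG; exists x.
have := Vb _ _ Vx Vy; rewrite lie_bracket_istring => Vxy.
(* The structure constant is 2 or -2 here, so dividing the bracket by it leaves the string
   itself. *)
have [_ _ /(_ (string_sign R x y)^-1 _ Vxy)] := Vs.
rewrite scalerA -rmorphM mulVf ?scale1r //.
by rewrite /string_sign xy; case: ifP; case: ifP => _ _; rewrite ?oppr_eq0 pnatr_eq0.
Qed.

End StringSpans.

(** * Simultaneous diagonalization of a commuting family in the matrix model of p *)

Section CommonFrame.
Local Open Scope classical_set_scope.
Variable R : rcfType.

(* (c, s) spans an eigenline of every symmetric 2x2 matrix T satisfying the
   displayed equation, (-s, c) the orthogonal one; c : s is the half-angle
   solution for a non-scalar matrix of the family. *)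
Lemma symmetric2_common_frame (Q : set 'M[R]_2) :
  (forall S T, Q S -> Q T ->
     S 0 1 * (T 0 0 - T 1 1) = T 0 1 * (S 0 0 - S 1 1)) ->
  exists c s : R, c ^+ 2 + s ^+ 2 != 0 /\
    forall T, Q T -> (c ^+ 2 - s ^+ 2) * T 0 1 = c * s * (T 0 0 - T 1 1).
Proof.
move=> Qcomm.
have [[T [QT T01]]|Q01] := pselect (exists T, Q T /\ T 0 1 != 0).
  (* For symmetric [T], [rho] is the gap between its eigenvalues, and [(d + rho, 2 * T 0 1)] is an
     eigenvector for the larger one. *)
  pose d := T 0 0 - T 1 1; pose rho := Num.sqrt (d ^+ 2 + 4 * T 0 1 ^+ 2).
  have rho2 : rho ^+ 2 = d ^+ 2 + 4 * T 0 1 ^+ 2.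
    by rewrite sqr_sqrtr // addr_ge0 ?sqr_ge0 // mulr_ge0 ?sqr_ge0.
  exists (d + rho), (2 * T 0 1); split.
    rewrite gt_eqF // ltr_wpDl ?sqr_ge0 // exprn_even_gt0 //=.
    by rewrite mulf_neq0 ?pnatr_eq0.
  move=> S /(Qcomm _ _ QT); rewrite -/d => ST.
  have -> : (d + rho) ^+ 2 - (2 * T 0 1) ^+ 2 = 2 * (d + rho) * d.
    by rewrite sqrrD rho2; ring.
  have -> : (d + rho) * (2 * T 0 1) * (S 0 0 - S 1 1) =
            2 * (d + rho) * (T 0 1 * (S 0 0 - S 1 1)) by ring.
  by rewrite ST; ring.
(* All off-diagonal entries vanish, so the standard axes serve. *)
exists 1, 0; rewrite expr1n expr0n /= addr0 oner_eq0; split=> // T QT.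
rewrite subr0 mul1r mulr0 mul0r; apply/eqP.
by apply/negPn/negP => T01; apply: Q01; exists T.
Qed.

Definition abelian_family m (Q : set 'M[R]_(m, 2)) : Prop :=
  forall X Y, Q X -> Q Y -> X^T *m Y = Y^T *m X /\ X *m Y^T = Y *m X^T.

(** With [frame2], an orthogonal but unnormalized frame; both vectors have squared length
    [c ^+ 2 + s ^+ 2]. *)
Definition frame1 (c s : R) : 'cV[R]_2 := \col_i (if i == 0 then c else s).
Definition frame2 (c s : R) : 'cV[R]_2 := \col_i (if i == 0 then - s else c).

Lemma mulmx2E (F : pzSemiRingType) p q (A : 'M[F]_(p, 2)) (B : 'M[F]_(2, q)) i j :
  (A *m B) i j = A i 0 * B 0 j + A i 1 * B 1 j.
Proof.
rewrite mxE !big_ord_recl big_ord0 addr0.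
by have -> : lift ord0 ord0 = 1 :> 'I_2 by apply/val_inj.
Qed.

Lemma cV_dotC m (x y : 'cV[R]_m) : x^T *m y = y^T *m x.
Proof.
apply/matrixP => i j; rewrite !ord1 !mxE.
by apply: eq_bigr => k _; rewrite !mxE mulrC.
Qed.

Lemma cV_dot_eq0 m (x : 'cV[R]_m) : ((x^T *m x) 0 0 == 0) = (x == 0).
Proof.
apply/eqP/eqP => [|->]; last by rewrite mulmx0 mxE.
rewrite mxE; under eq_bigr do rewrite mxE -expr2.
move/psumr_eq0P => x0; apply/colP => i; rewrite [RHS]mxE.
by apply/eqP; rewrite -sqrf_eq0 x0 // => j _; exact: sqr_ge0.
Qed.

Lemma frame_dot (c s : R) : ((frame1 c s)^T *m frame2 c s = 0) *
  ((frame1 c s)^T *m frame1 c s = (c ^+ 2 + s ^+ 2)%:M) *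
  ((frame2 c s)^T *m frame2 c s = (c ^+ 2 + s ^+ 2)%:M) *
  (frame1 c s *m (frame1 c s)^T + frame2 c s *m (frame2 c s)^T =
    (c ^+ 2 + s ^+ 2)%:M).
Proof.
do !split; try (apply/matrixP => i j; rewrite !ord1 !mxE !big_ord_recl big_ord0 !mxE /=; ring).
apply/matrixP => i j; rewrite !mxE !big_ord_recl !big_ord0 !mxE /=.
by case: i j => [[|[|]]] //= ? [[|[|]]] //= ?; rewrite ?mulr1n ?mulr0n; ring.
Qed.

(** The products X^T Y are symmetric and commute with each other, so they share a frame; in it their
    off-diagonal entry, which is the displayed product, vanishes. *)
Lemma abelian_family_frame m (Q : set 'M[R]_(m, 2)) : abelian_family Q ->
  exists c s : R, c ^+ 2 + s ^+ 2 != 0 /\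
    forall X Y, Q X -> Q Y -> (X *m frame1 c s)^T *m (Y *m frame2 c s) = 0.
Proof.
move=> Qab; have [|c [s [cs0 csP]]] := @symmetric2_common_frame
    [set T | exists X Y, [/\ Q X, Q Y & T = X^T *m Y]].
  move=> _ _ [X [Y [QX QY ->]]] [Z [W [QZ QW ->]]].
  pose S := X^T *m Y; pose T := Z^T *m W.
  have Ssym : S 1 0 = S 0 1.
    have ST : S^T = S by rewrite /S trmx_mul trmxK (Qab _ _ QX QY).1.
    by rewrite -[in RHS]ST [RHS]mxE.
  have Tsym : T 1 0 = T 0 1.
    have TT : T^T = T by rewrite /T trmx_mul trmxK (Qab _ _ QZ QW).1.
    by rewrite -[in RHS]TT [RHS]mxE.
  (* The two symmetry relations are used alternately: X^T (Y Z^T) W = (X^T Z) (Y^T W) = Z^T (X W^T)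
     Y = (Z^T W) (X^T Y). *)
  have /matrixP/(_ 0 1) : S *m T = T *m S.
    rewrite /S /T -!mulmxA [Y *m _]mulmxA (Qab _ _ QY QZ).2 !mulmxA.
    rewrite (Qab _ _ QX QZ).1 -!mulmxA (Qab _ _ QY QW).1.
    by rewrite [X *m _]mulmxA (Qab _ _ QX QW).2 !mulmxA.
  rewrite -/S -/T !mulmx2E; clearbody S T => e.
  by rewrite !mulrBr; lra.
exists c, s; split=> // X Y QX QY.
have Tcs := csP _ (ex_intro _ X (ex_intro _ Y (And3 QX QY erefl))).
rewrite trmx_mul -mulmxA [X^T *m _]mulmxA; set T := X^T *m Y in Tcs *.
have TT : T^T = T by rewrite /T trmx_mul trmxK (Qab _ _ QX QY).1.
have Tsym : T 1 0 = T 0 1 by rewrite -[in RHS]TT [RHS]mxE.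
clearbody T; apply/matrixP => i j; rewrite !ord1 mulmx2E [(frame1 c s)^T 0 0]mxE.
rewrite [(frame1 c s)^T 0 1]mxE !mulmx2E !mxE /=.
rewrite Tsym; move/eqP: Tcs; rewrite -subr_eq0 => /eqP Tcs.
by rewrite -[RHS]Tcs; ring.
Qed.

Lemma cV_orthogonal m (x : 'cV[R]_m.+2) :
  exists y : 'cV[R]_m.+2, y != 0 /\ x^T *m y = 0.
Proof.
have [x0|x0] := eqVneq (x 0 0) 0.
  exists (delta_mx 0 0); split.
    by apply/eqP => /matrixP/(_ 0 0)/eqP; rewrite !mxE !eqxx oner_eq0.
  by rewrite -colE; apply/matrixP => i j; rewrite !ord1 !mxE.
exists (x 0 0 *: delta_mx 1 0 - x 1 0 *: delta_mx 0 0); split.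
  apply/eqP => /matrixP/(_ 1 0)/eqP; rewrite !mxE /= mulr1 mulr0 subr0.
  exact/negP.
rewrite mulmxBr -!scalemxAr -!colE; apply/matrixP => i j.
by rewrite !ord1 !mxE mulrC subrr.
Qed.

(** Applying the symmetry relation to [U Y] kills the [W] terms by orthogonality and leaves [U X]
    times the squared length of [U Y] equal to a multiple of [U Y]. *)
Lemma parallel_columns m (I : Type) (Q : set I) (U W : I -> 'cV[R]_m) :
  (forall X Y, Q X -> Q Y -> U X *m (U Y)^T + W X *m (W Y)^T =
                            U Y *m (U X)^T + W Y *m (W X)^T) ->
  (forall X Y, Q X -> Q Y -> (W X)^T *m U Y = 0) ->
  forall X Y, Q X -> Q Y -> U Y != 0 -> exists a, U X = a *: U Y.
Proof.
move=> cross ort X Y QX QY UY0; have := congr1 (mulmx^~ (U Y)) (cross X Y QX QY).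
rewrite /= !mulmxDl -!mulmxA !ort // !mulmx0 !addr0.
rewrite [(U Y)^T *m _]mx11_scalar [(U X)^T *m _]mx11_scalar !mul_mx_scalar => e.
exists ((((U Y)^T *m U Y) 0 0)^-1 * ((U X)^T *m U Y) 0 0).
by rewrite -scalerA -e scalerA mulVf ?scale1r // cV_dot_eq0.
Qed.

Lemma abelian_family_cover m (Q : set 'M[R]_(m.+2, 2)) : abelian_family Q ->
  exists (u w : 'cV[R]_m.+2) (x y : 'cV[R]_2),
    [/\ u != 0 /\ w != 0, x != 0 /\ y != 0, u^T *m w = 0, x^T *m y = 0 &
      forall X, Q X -> exists a b, X = a *: (u *m x^T) + b *: (w *m y^T)].
Proof.
move=> Qab; have [c [s [cs0 ort]]] := abelian_family_frame Qab.
pose x := frame1 c s; pose y := frame2 c s; pose k := c ^+ 2 + s ^+ 2.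
have [[[xy xx] yy] xxyy] := frame_dot c s.
have splitE (A B : 'M[R]_(m.+2, 2)) :
    (A *m x) *m (B *m x)^T + (A *m y) *m (B *m y)^T = k *: (A *m B^T).
  rewrite !trmx_mul !mulmxA -mulmxDl -!(mulmxA A) -mulmxDr xxyy.
  by rewrite mul_mx_scalar -scalemxAl.
have cross X Y : Q X -> Q Y ->
    (X *m x) *m (Y *m x)^T + (X *m y) *m (Y *m y)^T =
    (Y *m x) *m (X *m x)^T + (Y *m y) *m (X *m y)^T.
  by move=> QX QY; rewrite !splitE (Qab _ _ QX QY).2.
have ort' X Y : Q X -> Q Y -> (X *m y)^T *m (Y *m x) = 0.
  by move=> QX QY; rewrite cV_dotC ort.
have parx := @parallel_columns _ _ Q (fun X => X *m x) (fun X => X *m y) cross ort'.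
have pary : forall X Y, Q X -> Q Y -> Y *m y != 0 -> exists a, X *m y = a *: (Y *m y).
  apply: (@parallel_columns _ _ Q (fun X => X *m y) (fun X => X *m x)) => //.
  by move=> X Y QX QY; rewrite addrC cross // addrC.
have x0 : x != 0.
  by rewrite -cV_dot_eq0 xx !mxE eqxx mulr1n.
have y0 : y != 0.
  by rewrite -cV_dot_eq0 yy !mxE eqxx mulr1n.
have [u [w [u0 w0 uw ux wy]]] : exists u w : 'cV[R]_m.+2,
    [/\ u != 0, w != 0, u^T *m w = 0, forall X, Q X -> exists a, X *m x = a *: u &
      forall X, Q X -> exists a, X *m y = a *: w].
  (* Any nonzero rotated column fixes its direction for the whole family. If all columns of one kind
     vanish, any direction orthogonal to the other is taken. *)
  have [[Y [QY Y0]]|Y0] := pselect (exists Y, Q Y /\ Y *m x != 0);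
  have [[Z [QZ Z0]]|Z0] := pselect (exists Z, Q Z /\ Z *m y != 0).
  - exists (Y *m x), (Z *m y); split=> // [|X QX|X QX]; first exact: ort.
      exact: parx.
    exact: pary.
  - have [w [w0 uw]] := cV_orthogonal (Y *m x).
    exists (Y *m x), w; split=> // X QX; first exact: parx.
    exists 0; rewrite scale0r; apply/eqP/negPn/negP => Xy; apply: Z0.
    by exists X.
  - have [u [u0 uw]] := cV_orthogonal (Z *m y).
    exists u, (Z *m y); split=> // [|X QX|X QX]; first by rewrite cV_dotC.
      exists 0; rewrite scale0r; apply/eqP/negPn/negP => Xx; apply: Y0.
      by exists X.
    exact: pary.
  - have d0 : delta_mx 0 0 != 0 :> 'cV[R]_m.+2.
      by apply/eqP => /matrixP/(_ 0 0)/eqP; rewrite !mxE !eqxx oner_eq0.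
    have [w [w0 uw]] := cV_orthogonal (delta_mx 0 0 : 'cV[R]_m.+2).
    exists (delta_mx 0 0), w; split=> // X QX; exists 0; rewrite scale0r;
      apply/eqP/negPn/negP => Xz; [apply: Y0 | apply: Z0]; by exists X.
exists u, w, x, y; split=> // X QX.
have [a Xx] := ux X QX; have [b Xy] := wy X QX; exists (k^-1 * a), (k^-1 * b).
(* The frame resolves the identity up to [k], which expands [X] in its rotated columns. *)
have kX : k *: X = (X *m x) *m x^T + (X *m y) *m y^T.
  by rewrite -!mulmxA -mulmxDr xxyy mul_mx_scalar.
rewrite Xx Xy -!scalemxAl in kX.
by rewrite -!scalerA -scalerDr -kX scalerA mulVf ?scale1r.
Qed.

End CommonFrame.

(** * Covering Abelian subalgebras by lines and by planes *)

Section MaximalAbelian.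
Local Open Scope classical_set_scope.
Variable R : realType.
Implicit Types T : pred string.

Lemma abelian_subalgebra_real_combos T d (b : 'I_d -> 'M[R[i]]_(2 * 2)) :
  (forall k, @string_span R T (b k)) ->
  (forall j k, lie_bracket (b j) (b k) = 0) ->
  abelian_subalgebra_in (@string_span R T) (real_combos b).
Proof.
move=> bT b0; have ab := real_combos_commute b0; split=> //.
  split=> [|X Y bX bY]; first exact: real_combos_subspace.
  by rewrite ab //; have [] := real_combos_subspace b.
move=> _ [c ->]; apply: real_subspace_sum => [|k]; first exact: string_span_subspace.
by have [_ _ TZ] := @string_span_subspace R T; exact: TZ.
Qed.

Lemma lie_bracketxx n (X : 'M[R[i]]_n) : lie_bracket X X = 0.
Proof. exact: subrr. Qed.

(** When commuting elements are proportional, any nonzero element of the subalgebra spans a covering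
    line; for the zero subalgebra the string [x0] supplies a line. *)
Lemma abelian_cover1 T x0 : T x0 ->
  (forall c d : string -> R,
     (forall x, ~~ T x -> c x = 0) -> (forall x, ~~ T x -> d x = 0) ->
     lie_bracket (combo c) (combo d) = 0 ->
     forall x y, c x * d y = c y * d x) ->
  forall a, abelian_subalgebra_in (@string_span R T) a ->
  exists b, [/\ abelian_subalgebra_in (@string_span R T) b, a `<=` b &
               has_real_dim b 1].
Proof.
move=> Tx0 par a [_ aab aT].
have [c [cT c0 cover]] : exists c : string -> R, [/\ forall x, ~~ T x -> c x = 0,
    exists y, c y != 0 & forall X, a X -> exists k : R, X = k%:C%C *: combo c].
  have [[c [cT ac [y cy]]]|noc] := pselect (exists c : string -> R,
      [/\ forall x, ~~ T x -> c x = 0, a (combo c) & exists y, c y != 0]).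
    exists c; split=> // [|X /[dup] aX /aT [d dT Xd]]; first by exists y.
    rewrite Xd in aX *; exists (d y / c y); rewrite comboZ; apply: eq_combo => x.
    apply: (mulfI cy); rewrite mulrA [c y * (_ / _)]mulrC divfK // [d y * _]mulrC.
    by apply: esym; apply: par => //; exact: aab.
  exists (fun y => (y == x0)%:R); split=> [x Tx| |X aX].
  - by case: eqP Tx => // ->; rewrite Tx0.
  - by exists x0; rewrite eqxx oner_eq0.
  exists 0; rewrite scale0r; have [d dT Xd] := aT _ aX.
  rewrite Xd -combo0; apply: eq_combo => x; apply/eqP/negPn/negP => dx.
  by apply: noc; exists d; rewrite -Xd; split=> //; exists x.
have [y cy] := c0; exists (@real_combos R _ 1 (fun=> combo c)); split.
- apply: abelian_subalgebra_real_combos => [k|j k]; first by exists c.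
  exact: lie_bracketxx.
- by move=> X /cover [k ->]; exists (fun=> k); rewrite big_ord1.
exists (fun=> combo c); split=> // k; rewrite big_ord1 comboZ -combo0 => /combo_inj.
by move=> /(_ y)/eqP; rewrite mulf_eq0 (negPf cy) orbF => /eqP k0 i; rewrite ord1.
Qed.

(** [V] transports the matrix model to the span. The covering plane is spanned by the dyads u x^T
    and w y^T, which commute because u is orthogonal to w and x to y. *)
Lemma abelian_cover2 T m (V : 'M[R]_(m.+2, 2) -> 'M[R[i]]_(2 * 2)) :
  (forall r s A B, V (r *: A + s *: B) = r%:C%C *: V A + s%:C%C *: V B) ->
  (forall A, V A = 0 -> A = 0) ->
  (forall X, @string_span R T X <-> exists A, X = V A) ->
  (forall A B, lie_bracket (V A) (V B) = 0 <->
     A^T *m B = B^T *m A /\ A *m B^T = B *m A^T) ->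
  forall a, abelian_subalgebra_in (@string_span R T) a ->
  exists b, [/\ abelian_subalgebra_in (@string_span R T) b, a `<=` b &
               has_real_dim b 2].
Proof.
move=> Vlin Vinj VT Vab a [_ aab aT].
have [u [w [x [y [[u0 w0] [x0 y0] uw xy cover]]]]] :
    exists (u w : 'cV[R]_m.+2) (x y : 'cV[R]_2),
    [/\ u != 0 /\ w != 0, x != 0 /\ y != 0, u^T *m w = 0, x^T *m y = 0 &
      forall A, a (V A) -> exists r s, A = r *: (u *m x^T) + s *: (w *m y^T)].
  apply: (@abelian_family_cover R m [set A | a (V A)]) => A B aA aB.
  by apply/Vab; exact: aab.
have wu : w^T *m u = 0 by rewrite cV_dotC.
have yx : y^T *m x = 0 by rewrite cV_dotC.
pose e (k : 'I_2) : 'M[R]_(m.+2, 2) := if k == 0 then u *m x^T else w *m y^T.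
have sumE (c : 'I_2 -> R) :
    \sum_k (c k)%:C%C *: V (e k) = V (c 0 *: (u *m x^T) + c 1 *: (w *m y^T)).
  rewrite Vlin !big_ord_recl big_ord0 addr0.
  by have -> : lift ord0 ord0 = 1 :> 'I_2 by apply/val_inj.
exists (real_combos (V \o e)); split.
- apply: abelian_subalgebra_real_combos => [k|j k]; first by apply/VT; exists (e k).
  apply/Vab; rewrite /e; case: (j == 0); case: (k == 0) => //=;
    rewrite !trmx_mul !trmxK !mulmxA -!(mulmxA x) -!(mulmxA y) ?uw ?wu;
    by rewrite -!(mulmxA u) -!(mulmxA w) ?xy ?yx !(mulmx0, mul0mx).
- move=> X /[dup] aX /aT /VT [A XA]; rewrite XA in aX *.
  have [r [s ->]] := cover _ aX; exists (fun k => if k == 0 then r else s).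
  by rewrite sumE.
exists (V \o e); split=> // c; rewrite sumE => /Vinj e0.
have dot_neq0 n (z : 'cV[R]_n) : z != 0 -> (z^T *m z) 0 0 != 0.
  by rewrite cV_dot_eq0.
have solve n (z : 'cV[R]_n) (t : R) : z != 0 -> t *: z = 0 -> t = 0.
  by move=> z0 /eqP; rewrite scaler_eq0 (negPf z0) orbF => /eqP.
(* Applying the relation to [x] removes the second dyad; applying it to [y] below removes the
   first. *)
have c0 : c 0 = 0.
  have /(congr1 (mulmx^~ x)) := e0; rewrite /= mul0mx mulmxDl -!scalemxAl -!mulmxA yx mulmx0.
  rewrite scaler0 addr0 [x^T *m x]mx11_scalar mul_mx_scalar scalerA => /(solve _ _ _ u0)/eqP.
  by rewrite mulf_eq0 (negPf (dot_neq0 _ _ x0)) orbF => /eqP.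
have c1 : c 1 = 0.
  have /(congr1 (mulmx^~ y)) := e0; rewrite /= mul0mx mulmxDl -!scalemxAl -!mulmxA xy mulmx0.
  rewrite scaler0 add0r [y^T *m y]mx11_scalar mul_mx_scalar scalerA => /(solve _ _ _ w0)/eqP.
  by rewrite mulf_eq0 (negPf (dot_neq0 _ _ y0)) orbF => /eqP.
move=> k; case: k => [[|[|]]] //= p; [rewrite -[RHS]c0|rewrite -[RHS]c1]; congr (c _);
  exact: val_inj.
Qed.

End MaximalAbelian.

(** * The dynamical Lie algebra and its Cartan decomposition in terms of strings *)

Section LieStrings.
Local Open Scope classical_set_scope.
Variable R : realType.

(** Makes the sum over the 16 strings explicit, so that bracket coefficients can be computed. *)
Lemma sum_string (F : string -> R) : \sum_x F x =
  \sum_(a <- [:: (true, false); (true, true); (false, true); (false, false)])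
    \sum_(b <- [:: (true, false); (true, true); (false, true); (false, false)])
       F (a, b).
Proof.
have sum_bits (G : pauli_bits -> R) : \sum_a G a =
    \sum_(a <- [:: (true, false); (true, true); (false, true); (false, false)]) G a.
  rewrite !big_cons big_nil addr0.
  transitivity (\sum_(p : bool) \sum_(q : bool) G (p, q)).
    rewrite pair_bigA; apply: eq_bigr => -[p q] _ //.
  by rewrite big_bool !big_bool /=; ring.
transitivity (\sum_(a : pauli_bits) \sum_(b : pauli_bits) F (a, b)).
  by rewrite pair_bigA; apply: eq_bigr => -[p q].
by rewrite sum_bits; apply: eq_bigr => a _; rewrite sum_bits.
Qed.

(** One round of brackets, performed on strings; its iterates stay inside the generated Lie
    algebra. *)
Definition closure_step (l : seq string) : seq string :=
  undup (l ++ [seq string_add x y | x <- l, y <- [seq y <- l | string_anti x y]]).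

Lemma closure_step_ind (P : string -> Prop) (l : seq string) n :
  (forall x, x \in l -> P x) ->
  (forall x y, P x -> P y -> string_anti x y -> P (string_add x y)) ->
  forall x, x \in iter n closure_step l -> P x.
Proof.
move=> lP Padd; elim: n => [|n IHn] x /=; first exact: lP.
rewrite /closure_step mem_undup mem_cat => /orP[/IHn //|/allpairsPdep[y [z [yl]]]].
by rewrite mem_filter => /andP[yz zl] ->; apply: Padd; auto.
Qed.

Definition bits_of (a : 'I_3) : pauli_bits :=
  nth (false, false) [:: (true, false); (true, true); (false, true)] a.

Lemma pauli_bits_of a : pauli R a = pauli_of R (bits_of a).
Proof. by case: a => [[|[|[|]]]]. Qed.

Lemma bits_of_neq0 a : bits_of a != (false, false).
Proof. by case: a => [[|[|[|]]]]. Qed.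

Lemma bits_ofP p : p != (false, false) -> exists a, p = bits_of a.
Proof.
by case: p => [[] []] // _;
  [exists (@Ordinal 3 1 isT) | exists (@Ordinal 3 0 isT) | exists (@Ordinal 3 2 isT)].
Qed.

Definition nonlocal_string : pred string :=
  fun x => (x.1 != (false, false)) && (x.2 != (false, false)).

Definition local_string : pred string :=
  fun x => (x.1 == (false, false)) (+) (x.2 == (false, false)).

(* The non-local strings of L: the flags tell whether O_S, O_B, O_c differ from
   sigma_3. *)
Definition lie_p (s b c : bool) : pred string := fun x =>
  (if c then x.1 != (false, false) else if s then x.1.1 else x.1 == (false, true))
  && (if b then x.2.1 else x.2 == (false, true)).

(** Only [O_c] matters: a control other than sigma_3 generates all qubit rotations together with
    sigma_3, and brackets of non-local strings yield no further local ones. *)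
Definition lie_k (c : bool) : pred string := fun x =>
  (x == ((false, false), (false, true))) ||
  (x.2 == (false, false)) &&
    (if c then x.1 != (false, false) else x.1 == (false, true)).

Definition lie_strings (s b c : bool) : pred string := fun x =>
  lie_k c x || lie_p s b c x.

Lemma lie_strings_closed s b c : string_closed (lie_strings s b c).
Proof.
by case: s b c => [] [] [] [[[] []] [[] []]] [[[] []] [[] []]].
Qed.

Definition lie_gens (s b c : 'I_3) : seq string :=
  [:: ((false, true), (false, false)); ((false, false), (false, true));
      (bits_of c, (false, false)); (bits_of s, bits_of b)].

(** Four rounds of brackets reach every string in all 27 cases, by computation. *)
Lemma lie_strings_reach s b c x :
  lie_strings (bits_of s).1 (bits_of b).1 (bits_of c).1 x ->
  x \in iter 4 closure_step (lie_gens s b c).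
Proof.
case: s => [[|[|[|]]]] // ps; case: b => [[|[|[|]]]] // pb;
case: c => [[|[|[|]]]] // pc; rewrite /lie_gens /bits_of /=;
by case: x => [[[] []] [[] []]]; vm_compute.
Qed.

Lemma lie_gens_strings s b c x : x \in lie_gens s b c ->
  lie_strings (bits_of s).1 (bits_of b).1 (bits_of c).1 x.
Proof.
case: s => [[|[|[|]]]] // ps; case: b => [[|[|[|]]]] // pb;
case: c => [[|[|[|]]]] // pc; rewrite /lie_gens /bits_of /=;
by case: x => [[[] []] [[] []]]; vm_compute.
Qed.

Lemma dynamical_lie_algebraE s b c :
  dynamical_lie_algebra (pauli R s) (pauli R b) (pauli R c) =
  string_span (lie_strings (bits_of s).1 (bits_of b).1 (bits_of c).1).
Proof.
rewrite -(@lie_generated_istrings R (mem (lie_gens s b c))).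
- rewrite !pauli_bits_of; congr lie_generated; apply/seteqP; split=> X /=.
    case=> ->; [exists ((false, true), (false, false))
               |exists ((false, false), (false, true))
               |exists (bits_of c, (false, false))
               |exists (bits_of s, bits_of b)] => //;
      by rewrite /= !inE ?eqxx ?orbT.
  case=> x; rewrite /= !inE => /or4P[] /eqP -> ->;
    [exact: Or41 | exact: Or42 | exact: Or43 | exact: Or44].
- by move=> x /lie_gens_strings.
- exact: lie_strings_closed.
- move=> P lP Padd x /lie_strings_reach.
  exact: closure_step_ind.
Qed.

Lemma real_span_local : real_span (@local_operators R) = string_span local_string.
Proof.
rewrite -real_span_istrings; congr real_span; apply/seteqP; split=> X /=.
  case=> a [] ->; rewrite pauli_bits_of.
    by exists (bits_of a, (false, false)) => //; move: (bits_of_neq0 a); case: (bits_of a) => [[] []].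
  by exists ((false, false), bits_of a) => //; move: (bits_of_neq0 a); case: (bits_of a) => [[] []].
case=> -[p q]; rewrite /local_string /= => pq ->.
have [p0|/bits_ofP[a pa]] := eqVneq p (false, false).
  subst p; have /bits_ofP[a qa] : q != (false, false) by case: (q) pq => [[] []].
  by exists a; right; rewrite pauli_bits_of qa.
have q0 : q = (false, false).
  by move: pq (bits_of_neq0 a); rewrite pa; case: (q) (bits_of a) => [[] []] [[] []].
by exists a; left; rewrite pauli_bits_of q0 pa.
Qed.

Lemma real_span_nonlocal :
  real_span (@nonlocal_operators R) = string_span nonlocal_string.
Proof.
rewrite -real_span_istrings; congr real_span; apply/seteqP; split=> X /=.
  case=> a [b ->]; exists (bits_of a, bits_of b); rewrite ?pauli_bits_of //.
  by rewrite /nonlocal_string /= !bits_of_neq0.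
case=> -[p q] /andP[/bits_ofP[a pa] /bits_ofP[b qb]] ->; exists a, b.
by rewrite !pauli_bits_of -pa -qb.
Qed.

Lemma eq_string_span S T : S =1 T -> @string_span R S = string_span T.
Proof.
by move=> ST; apply/seteqP; split=> _ [c cS ->]; exists c => // x Tx; apply: cS;
  rewrite ?ST // -?ST.
Qed.

Lemma cartan_pE s b c :
  cartan_p (string_span (lie_strings s b c)) = @string_span R (lie_p s b c).
Proof.
rewrite /cartan_p real_span_nonlocal string_spanI; apply: eq_string_span => x /=.
by case: s b c => [] [] []; case: x => [[[] []] [[] []]].
Qed.

Lemma cartan_kE s b c :
  cartan_k (string_span (lie_strings s b c)) = @string_span R (lie_k c).
Proof.
rewrite /cartan_k real_span_local string_spanI; apply: eq_string_span => x /=.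
by case: s b c => [] [] []; case: x => [[[] []] [[] []]].
Qed.

Lemma string_span_direct_sum s b c :
  direct_sum_decomposition (@string_span R (lie_strings s b c))
    (string_span (lie_k c)) (string_span (lie_p s b c)).
Proof.
split; last first.
  rewrite string_spanI; apply/seteqP; split=> [_ [d d0 ->]|_ ->]; last first.
    by have [] := @string_span_subspace R (predI (lie_k c) (lie_p s b c)).
  rewrite /= -combo0; apply: eq_combo => x; apply: d0.
  by case: s b c => [] [] []; case: x => [[[] []] [[] []]].
apply/seteqP; split=> [_ [d dS ->]|_ [_ [d dk ->] [_ [e ep ->] <-]]].
  exists (combo (fun x => if lie_k c x then d x else 0)).
    by exists (fun x => if lie_k c x then d x else 0) => // x /negPf ->.
  exists (combo (fun x => if lie_k c x then 0 else d x)).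
    exists (fun x => if lie_k c x then 0 else d x) => // x xp.
    by case: ifP => // xk; apply: dS; rewrite /lie_strings xk.
  rewrite comboD; apply: eq_combo => x; case: ifP => _; by rewrite ?addr0 ?add0r.
rewrite comboD; exists (fun x => d x + e x) => // x.
by rewrite negb_or => /andP[/dk -> /ep ->]; rewrite addr0.
Qed.

End LieStrings.

(** * The Cartan dimension for every choice of operators *)

Section CartanCases.
Local Open Scope classical_set_scope.
Variable R : realType.

(** Coefficients as a 3x2 matrix: rows are sigma_1, sigma_2, sigma_3 on the qubit, columns sigma_1,
    sigma_2 on the ancilla. *)
Definition grid_coef (a00 a01 a10 a11 a20 a21 : R) : string -> R := fun x =>
  match x with
  | ((true, false), (true, false)) => a00
  | ((true, false), (true, true)) => a01
  | ((true, true), (true, false)) => a10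
  | ((true, true), (true, true)) => a11
  | ((false, true), (true, false)) => a20
  | ((false, true), (true, true)) => a21
  | _ => 0
  end.

Lemma grid_coefE (c : string -> R) : (forall x, ~~ lie_p true true true x -> c x = 0) ->
  c =1 grid_coef
    (c ((true, false), (true, false))) (c ((true, false), (true, true)))
    (c ((true, true), (true, false))) (c ((true, true), (true, true)))
    (c ((false, true), (true, false))) (c ((false, true), (true, true))).
Proof. by move=> cT [[[] []] [[] []]] //; apply: cT. Qed.

Lemma grid_coef_supp a00 a01 a10 a11 a20 a21 x :
  ~~ lie_p true true true x -> grid_coef a00 a01 a10 a11 a20 a21 x = 0.
Proof. by case: x => [[[] []] [[] []]]. Qed.

Lemma lie_bracket_eq0 (c d : string -> R) :
  lie_bracket (combo c) (combo d) = 0 <-> forall z, bracket_coef c d z = 0.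
Proof.
rewrite lie_bracket_combo -combo0; split=> [/combo_inj //|]; exact: eq_combo.
Qed.

(** The bracket is local. The first equation is its component along 1 (x) sigma_3 and says that A^T
    B is symmetric; the others are those along sigma_3, sigma_2, sigma_1 on the qubit and say the
    same of A B^T. *)
Lemma lie_bracket_grid a00 a01 a10 a11 a20 a21 b00 b01 b10 b11 b20 b21 :
  lie_bracket (combo (grid_coef a00 a01 a10 a11 a20 a21))
              (combo (grid_coef b00 b01 b10 b11 b20 b21)) = 0 <->
  [/\ a00 * b01 + a10 * b11 + a20 * b21 = a01 * b00 + a11 * b10 + a21 * b20,
      a00 * b10 + a01 * b11 = a10 * b00 + a11 * b01,
      a00 * b20 + a01 * b21 = a20 * b00 + a21 * b01 &
      a10 * b20 + a11 * b21 = a20 * b10 + a21 * b11].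
Proof.
rewrite lie_bracket_eq0; split=> [br0|[e0 e1 e2 e3] z].
  have := br0 ((false, false), (false, true)).
  have := br0 ((false, true), (false, false)).
  have := br0 ((true, true), (false, false)).
  have := br0 ((true, false), (false, false)).
  rewrite /bracket_coef !sum_string !big_cons !big_nil /string_sign /=.
  by rewrite !(mul0r, mulr0, add0r, addr0) => z1 z2 z3 z4; split; lra.
rewrite /bracket_coef sum_string !big_cons !big_nil /string_sign.
by case: z => [[[] []] [[] []]] /=; rewrite !(mul0r, mulr0, add0r, addr0) //; lra.
Qed.

Lemma ord2_ind (P : 'I_2 -> Prop) : P 0 -> P 1 -> forall i, P i.
Proof.
move=> P0 P1 [[|[|]]] //= p; [move: P0 | move: P1]; congr P; exact: val_inj.
Qed.

Lemma ord3_ind (P : 'I_3 -> Prop) : P 0 -> P 1 -> P ord_max -> forall i, P i.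
Proof.
move=> P0 P1 P2 [[|[|[|]]]] //= p; [move: P0 | move: P1 | move: P2]; congr P;
  exact: val_inj.
Qed.

Lemma mx_commute_grid m (A B : 'M[R]_(m, 2)) :
  (A^T *m B = B^T *m A /\ A *m B^T = B *m A^T) <->
  (\sum_i A i 0 * B i 1 = \sum_i A i 1 * B i 0 /\
   forall i j, A i 0 * B j 0 + A i 1 * B j 1 = A j 0 * B i 0 + A j 1 * B i 1).
Proof.
split=> [[e f]|[e f]]; split.
- have /matrixP/(_ 0 1) := e; rewrite !mxE => E.
  transitivity (\sum_i A^T 0 i * B i 1); first by apply: eq_bigr => i _; rewrite mxE.
  by rewrite E; apply: eq_bigr => i _; rewrite mxE mulrC.
- move=> i j; have /matrixP/(_ i j) := f; rewrite !mulmx2E !mxE => ->; ring.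
- have e' : \sum_i A i 1 * B i 0 = \sum_i A i 0 * B i 1 by [].
  apply/matrixP => i j; rewrite !mxE.
  under eq_bigr do rewrite mxE.
  under [RHS]eq_bigr do rewrite mxE mulrC.
  by elim/ord2_ind: i; elim/ord2_ind: j.
- by apply/matrixP => i j; rewrite !mulmx2E !mxE f; ring.
Qed.

Definition grid3 (A : 'M[R]_(3, 2)) : 'M[R[i]]_(2 * 2) :=
  combo (grid_coef (A 0 0) (A 0 1) (A 1 0) (A 1 1) (A ord_max 0) (A ord_max 1)).

(** The model of p for [O_c] equal to sigma_3 and [O_S], [O_B] different from it: no sigma_3 occurs
    on the qubit. *)
Definition grid2 (A : 'M[R]_(2, 2)) : 'M[R[i]]_(2 * 2) :=
  combo (grid_coef (A 0 0) (A 0 1) (A 1 0) (A 1 1) 0 0).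

Lemma grid_coef_lin (r s : R) a00 a01 a10 a11 a20 a21 b00 b01 b10 b11 b20 b21 :
  r%:C%C *: combo (grid_coef a00 a01 a10 a11 a20 a21) +
  s%:C%C *: combo (grid_coef b00 b01 b10 b11 b20 b21) =
  combo (grid_coef (r * a00 + s * b00) (r * a01 + s * b01) (r * a10 + s * b10)
                   (r * a11 + s * b11) (r * a20 + s * b20) (r * a21 + s * b21)).
Proof.
rewrite !comboZ comboD; apply: eq_combo => -[[[] []] [[] []]] //=;
  by rewrite !mulr0 addr0.
Qed.

Lemma abelian_cover_grid3 a :
  abelian_subalgebra_in (string_span (lie_p true true true)) a ->
  exists b, [/\ abelian_subalgebra_in (@string_span R (lie_p true true true)) b,
                a `<=` b & has_real_dim b 2].
Proof.
apply: (@abelian_cover2 R _ 1 grid3) => [r s A B|A|X|A B].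
- by rewrite /grid3 grid_coef_lin !mxE.
- rewrite /grid3 -combo0 => /combo_inj A0; apply/matrixP => i j; rewrite mxE.
  elim/ord3_ind: i; elim/ord2_ind: j.
  + exact: A0 ((true, false), (true, false)).
  + exact: A0 ((true, false), (true, true)).
  + exact: A0 ((true, true), (true, false)).
  + exact: A0 ((true, true), (true, true)).
  + exact: A0 ((false, true), (true, false)).
  + exact: A0 ((false, true), (true, true)).
- split=> [[c cT ->]|[A ->]].
    exists (\matrix_(i, j) c (bits_of i, (true, j != 0))).
    by rewrite /grid3 !mxE /=; apply: eq_combo => x; exact: grid_coefE.
  by eexists; last reflexivity; exact: grid_coef_supp.
rewrite /grid3 lie_bracket_grid mx_commute_grid !big_ord_recl !big_ord0 !addr0.
have -> : lift ord0 ord0 = 1 :> 'I_3 by apply/val_inj.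
have -> : lift ord0 (lift ord0 ord0) = ord_max :> 'I_3 by apply/val_inj.
rewrite !addrA; split=> [[e0 e1 e2 e3]|[e0 e]]; last first.
  by split; [exact: e0 | exact: e | exact: e | exact: e].
split=> // i j; elim/ord3_ind: i; elim/ord3_ind: j => //; exact: esym.
Qed.

Lemma abelian_cover_grid2 a :
  abelian_subalgebra_in (string_span (lie_p true true false)) a ->
  exists b, [/\ abelian_subalgebra_in (@string_span R (lie_p true true false)) b,
                a `<=` b & has_real_dim b 2].
Proof.
apply: (@abelian_cover2 R _ 0 grid2) => [r s A B|A|X|A B].
- by rewrite /grid2 grid_coef_lin !mxE !mulr0 !addr0.
- rewrite /grid2 -combo0 => /combo_inj A0; apply/matrixP => i j; rewrite mxE.
  elim/ord2_ind: i; elim/ord2_ind: j.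
  + exact: A0 ((true, false), (true, false)).
  + exact: A0 ((true, false), (true, true)).
  + exact: A0 ((true, true), (true, false)).
  + exact: A0 ((true, true), (true, true)).
- split=> [[c cT ->]|[A ->]].
    exists (\matrix_(i < 2, j < 2) c ((true, i != 0), (true, j != 0))).
    rewrite /grid2 !mxE /=; apply: eq_combo => -[[[] []] [[] []]] //; exact: cT.
  eexists; last reflexivity; by move=> [[[] []] [[] []]].
rewrite /grid2 lie_bracket_grid mx_commute_grid !big_ord_recl !big_ord0.
have -> : lift ord0 ord0 = 1 :> 'I_2 by apply/val_inj.
rewrite !(mul0r, mulr0, addr0); split=> [[e0 e1 _ _]|[e0 e]]; last first.
  by split=> //; exact: e.
split=> // i j; elim/ord2_ind: i; elim/ord2_ind: j => //; exact: esym.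
Qed.

Definition line_coef (a0 a1 a2 : R) : string -> R := fun x =>
  match x with
  | ((true, false), (false, true)) => a0
  | ((true, true), (false, true)) => a1
  | ((false, true), (false, true)) => a2
  | _ => 0
  end.

(** With sigma_3 on the ancilla throughout, the bracket is, up to a factor, the cross product of the
    coefficient vectors. *)
Lemma lie_bracket_line a0 a1 a2 b0 b1 b2 :
  lie_bracket (combo (line_coef a0 a1 a2)) (combo (line_coef b0 b1 b2)) = 0 ->
  [/\ a0 * b1 = a1 * b0, a0 * b2 = a2 * b0 & a1 * b2 = a2 * b1].
Proof.
move/lie_bracket_eq0 => br0.
have := br0 ((false, true), (false, false)).
have := br0 ((true, true), (false, false)).
have := br0 ((true, false), (false, false)).
rewrite /bracket_coef !sum_string !big_cons !big_nil /string_sign /=.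
by rewrite !(mul0r, mulr0, add0r, addr0) => z1 z2 z3; split; lra.
Qed.

Lemma lie_bracket_proportional s b c (d e : string -> R) : ~~ (b && (s || c)) ->
  (forall x, ~~ lie_p s b c x -> d x = 0) ->
  (forall x, ~~ lie_p s b c x -> e x = 0) ->
  lie_bracket (combo d) (combo e) = 0 -> forall x y, d x * e y = d y * e x.
Proof.
case: b => [|_] /=.
  rewrite negb_or => /andP[/negPf -> /negPf ->] dT eT.
  (* Here p is spanned by sigma_3 (x) sigma_1 and sigma_3 (x) sigma_2, the last row of the grid, and
     the bracket is a 2x2 determinant. *)
  pose f (g : string -> R) := grid_coef 0 0 0 0
    (g ((false, true), (true, false))) (g ((false, true), (true, true))).
  have df : d =1 f d by move=> [[[] []] [[] []]] //; exact: dT.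
  have ef : e =1 f e by move=> [[[] []] [[] []]] //; exact: eT.
  rewrite (eq_combo df) (eq_combo ef) lie_bracket_grid !mul0r !add0r.
  move=> [de _ _ _] x y; rewrite !(df x) !(df y) !(ef x) !(ef y).
  move: x y => [[[] []] [[] []]] [[[] []] [[] []]] /=; rewrite ?(mul0r, mulr0) //.
(* For [O_B] equal to sigma_3, p lies in the span of all sigma_a (x) sigma_3, where the cross
   product decides. *)
have sub x : lie_p s false c x -> lie_p true false true x.
  by case: s c x => [] [] [[[] []] [[] []]].
move=> dT eT; pose f (g : string -> R) := line_coef
  (g ((true, false), (false, true))) (g ((true, true), (false, true)))
  (g ((false, true), (false, true))).
have df : d =1 f d.
  by move=> [[[] []] [[] []]] //; apply: dT; apply: contraNN (sub _) _.
have ef : e =1 f e.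
  by move=> [[[] []] [[] []]] //; apply: eT; apply: contraNN (sub _) _.
rewrite (eq_combo df) (eq_combo ef) => /lie_bracket_line[e1 e2 e3] x y.
rewrite !(df x) !(df y) !(ef x) !(ef y).
by move: x y => [[[] []] [[] []]] [[[] []] [[] []]] /=; rewrite ?(mul0r, mulr0).
Qed.

Lemma cartan_dim_lie (s b c : bool) :
  cartan_dim (@string_span R (lie_strings s b c)) (if b && (s || c) then 2 else 1).
Proof.
apply: cartan_dim_cover; rewrite cartan_pE; first exact: string_span_subspace.
case: ifP => [|/negbT sbc]; last first.
  (* This string has sigma_1 where the flag is set and sigma_3 elsewhere, so it always lies in p. *)
  apply: (abelian_cover1 (x0 := ((s, ~~ s), (b, ~~ b)))).
    by move: sbc; case: s b c => [] [] [].
  by move=> d e; exact: lie_bracket_proportional.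
case: b => //; case: c => [_|]; last by case: s => // _; exact: abelian_cover_grid2.
(* Full qubit control makes p independent of [O_S]. *)
have -> : @string_span R (lie_p s true true) = string_span (lie_p true true true).
  by apply: eq_string_span => x; case: s.
exact: abelian_cover_grid3.
Qed.

End CartanCases.

(** * Unital maps from conserved operators, and purification by the iSWAP gate *)

Section Purification.
Local Open Scope classical_set_scope.
Variable R : realType.
Local Notation C := R[i].

(** The unitary matrices commuting with [Z] form a group containing all exponentials of [V], hence
    the group they generate. *)
Lemma connected_lie_group_sub n (V : set 'M[C]_n) (Z : 'M[C]_n) :
  (forall X, V X -> adjmx X = - X) -> (forall X, V X -> X *m Z = Z *m X) ->
  forall U, connected_lie_group V U -> U *m adjmx U = 1%:M /\ U *m Z = Z *m U.
Proof.
move=> Vanti VZ; pose H : set 'M[C]_n := [set U | U *m adjmx U = 1%:M /\ U *m Z = Z *m U].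
suff : connected_lie_group V `<=` H by [].
have adj1 : adjmx 1%:M = 1%:M :> 'M[C]_n by rewrite /adjmx trmx1 map_mx1.
apply: smallest_sub; last first.
  by move=> _ [X VX <-]; split; [exact/expmx_unitary/Vanti|apply: expmx_comm; auto].
split=> [X [/mulmx1_unit[]] //| |X Y [X1 XZ] [Y1 YZ]|X [X1 XZ]].
- by rewrite /H /= adj1 !mulmx1 mul1mx.
- split; last by rewrite -mulmxA YZ mulmxA XZ mulmxA.
  by rewrite adjmxM mulmxA -(mulmxA X) Y1 mulmx1.
have [XU _] := mulmx1_unit X1.
have XV : invmx X = adjmx X by rewrite -[LHS]mulmx1 -X1 mulKmx.
split; first by rewrite XV adjmxK; exact: mulmx1C.
by rewrite -[LHS]mulmx1 -(mulmxV XU) !mulmxA -(mulmxA _ Z) -XZ mulmxA mulVmx // mul1mx.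
Qed.

Lemma adjmx_tens m n (A : 'M[C]_m) (B : 'M[C]_n) :
  adjmx (A *t B) = adjmx A *t adjmx B.
Proof. by rewrite /adjmx trmx_tens map_mxT. Qed.

Lemma adjmx_pauli_of a : adjmx (pauli_of R a) = pauli_of R a.
Proof.
case: a => [[] []]; rewrite /pauli_of /= ?mx2_1; apply/matrixP => i j;
  rewrite !mxE; elim/ord2_ind: i; elim/ord2_ind: j => /=;
  by apply/eqP; rewrite eq_complex /= !(oppr0, opprK) !eqxx.
Qed.

Lemma adjmx_string_span (S : pred string) X : @string_span R S X -> adjmx X = - X.
Proof.
apply: (string_span_sub (V := [set X | adjmx X = - X])) => {X} [|x _] /=.
  split=> [|X Y /= XE YE|r X /= XE].
  - by rewrite /= oppr0 /adjmx trmx0 map_mx0.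
  - by rewrite /adjmx linearD map_mxD -!/(adjmx _) XE YE opprD.
  - rewrite /adjmx linearZ map_mxZ -/(adjmx _) XE scalerN; congr (- (_ *: _)).
    by apply/eqP; rewrite eq_complex /= oppr0 !eqxx.
rewrite /istring /string_mx /adjmx linearZ map_mxZ -/(adjmx _) adjmx_tens !adjmx_pauli_of.
rewrite -scaleNr; congr (_ *: _).
by apply/eqP; rewrite eq_complex /= oppr0 !eqxx.
Qed.

Lemma string_span_comm (S : pred string) z X : (forall x, S x -> ~~ string_anti x z) ->
  string_span S X -> X *m istring R z = istring R z *m X.
Proof.
move=> Sz XS; apply/eqP; rewrite -subr_eq0; apply/eqP; move: X XS.
apply: (string_span_sub (V := [set X | X *m istring R z - istring R z *m X = 0])).
  split=> [|X Y /= XE YE|r X /= XE].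
  - by rewrite /= mul0mx mulmx0 subrr.
  - by rewrite mulmxDl mulmxDr opprD addrACA XE YE addr0.
  - by rewrite -(scalemxAl r%:C%C) -(scalemxAr r%:C%C) -scalerBr XE scaler0.
move=> x /Sz /negPf xz; have := lie_bracket_istring R x z.
by rewrite /string_sign xz scale0r.
Qed.

Lemma sum_tens_index m n (F : 'I_(m * n) -> C) :
  \sum_i F i = \sum_i \sum_j F (mxtens_index (i, j)).
Proof.
rewrite pair_bigA (reindex (@mxtens_index m n)) /=; last first.
  exists (@mxtens_unindex m n) => i _; [exact: mxtens_indexK|exact: mxtens_unindexK].
by apply: eq_bigr => -[i j].
Qed.

Lemma ptraceB_tens (A B : 'M[C]_2) : ptraceB (A *t B) = \tr B *: A.
Proof.
apply/matrixP => i j; rewrite !mxE /mxtrace mulr_suml; apply: eq_bigr => k _.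
by rewrite tensmxE mulrC.
Qed.

Lemma ptraceB_tr (Y : 'M[C]_(2 * 2)) : \tr (ptraceB Y) = \tr Y.
Proof.
by rewrite /mxtrace sum_tens_index; apply: eq_bigr => i _; rewrite mxE.
Qed.

Lemma ptraceB_mulr (Y : 'M[C]_(2 * 2)) (A : 'M[C]_2) :
  ptraceB (Y *m (A *t 1%:M)) = ptraceB Y *m A.
Proof.
apply/matrixP => i j; rewrite !mxE.
under eq_bigr do rewrite mxE sum_tens_index.
rewrite exchange_big /=; apply: eq_bigr => p _; rewrite mxE mulr_suml.
apply: eq_bigr => k _; rewrite (bigD1 k) //= big1 => [|q /negPf qk].
  by rewrite tensmxE mxE eqxx mulr1 addr0.
by rewrite tensmxE [1%:M _ _]mxE qk !mulr0.
Qed.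

Lemma ptraceB_mull (Y : 'M[C]_(2 * 2)) (A : 'M[C]_2) :
  ptraceB ((A *t 1%:M) *m Y) = A *m ptraceB Y.
Proof.
apply/matrixP => i j; rewrite !mxE.
under eq_bigr do rewrite mxE sum_tens_index.
rewrite exchange_big /=; apply: eq_bigr => p _; rewrite mxE mulr_sumr.
apply: eq_bigr => k _; rewrite (bigD1 k) //= big1 => [|q /negPf qk].
  by rewrite tensmxE mxE eqxx mulr1 addr0.
by rewrite tensmxE [1%:M _ _]mxE eq_sym qk mulr0 mul0r.
Qed.

Lemma ancilla_stateE (pe pg : R) : ancilla_state pe pg =
  ((pe + pg) / 2)%:C%C *: 1%:M + ((pe - pg) / 2)%:C%C *: sigma3 R.
Proof.
rewrite mx2_1 !mx2_scale; apply/matrixP => i j; rewrite !mxE.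
have e : ((pe + pg) / 2) + (pe - pg) / 2 = pe by field.
have g : ((pe + pg) / 2) - (pe - pg) / 2 = pg by field.
elim/ord2_ind: i; elim/ord2_ind: j => /=; rewrite ?mulr0 ?addr0 // ?mulr1 ?mulrN1.
  by rewrite -rmorphD e.
by rewrite -rmorphB g.
Qed.

Lemma ancilla_state_tr (pe pg : R) : pe + pg = 1 -> \tr (ancilla_state pe pg) = 1.
Proof. by move=> pe1; rewrite mx2_tr -rmorphD pe1. Qed.

Lemma tensmx11 m n : (1%:M : 'M[C]_m) *t (1%:M : 'M[C]_n) = 1%:M.
Proof.
apply/matrixP => i j; rewrite -(mxtens_unindexK i) -(mxtens_unindexK j).
case: (mxtens_unindex i) (mxtens_unindex j) => [{}i k] [{}j l]; rewrite tensmxE !mxE -natrM mulnb; congr ((_ : bool)%:R).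
by rewrite (can_eq (@mxtens_indexK m n)) xpair_eqE.
Qed.

(** The state 1 (x) rho is left invariant by conjugation with [U], and its partial trace is 1. *)
Lemma unital_of_ancilla_comm (U : 'M[C]_(2 * 2)) (rho : 'M[C]_2) : \tr rho = 1 ->
  U *m adjmx U = 1%:M -> U *m (1%:M *t rho) = (1%:M *t rho) *m U ->
  unital (qubit_map U rho).
Proof.
move=> rho1 UU Urho; rewrite /unital /qubit_map Urho -mulmxA UU mulmx1.
by rewrite ptraceB_tens rho1 scale1r.
Qed.

(** The image D of 1 commutes with sigma_3, hence is diagonal. Conservation of sigma_3 (x) 1 gives
    tr (D sigma_3) = 0, and tr D = 2, so D = 1. *)
Lemma unital_of_qubit_comm (U : 'M[C]_(2 * 2)) (rho : 'M[C]_2) : \tr rho = 1 ->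
  U *m adjmx U = 1%:M -> U *m (sigma3 R *t 1%:M) = (sigma3 R *t 1%:M) *m U ->
  unital (qubit_map U rho).
Proof.
move=> rho1 UU; set Z := sigma3 R *t 1%:M => UZ; have UU' := mulmx1C UU.
have U'Z : adjmx U *m Z = Z *m adjmx U.
  by rewrite -[LHS]mulmx1 -UU !mulmxA -(mulmxA _ Z) -UZ mulmxA UU' mul1mx.
have rhoZ : (1%:M *t rho) *m Z = Z *m (1%:M *t rho).
  by rewrite !tensmx_mul !mulmx1 !mul1mx.
set Y := U *m (1%:M *t rho) *m adjmx U.
have YZ : Y *m Z = Z *m Y.
  by rewrite /Y -mulmxA U'Z !mulmxA -(mulmxA U) rhoZ mulmxA UZ.
rewrite /unital /qubit_map -/Y; set D := ptraceB Y.
have DZ : D *m sigma3 R = sigma3 R *m D by rewrite -ptraceB_mulr -ptraceB_mull YZ.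
have trD : \tr D = 2.
  rewrite ptraceB_tr /Y mxtrace_mulC mulmxA UU' mul1mx tensmx_tr rho1 mulr1.
  by rewrite mxtrace1.
have trDZ : \tr (D *m sigma3 R) = 0.
  rewrite -ptraceB_mulr ptraceB_tr -/Z /Y -mulmxA U'Z mulmxA mxtrace_mulC.
  rewrite !mulmxA UU' mul1mx tensmx_mul tensmx_tr mul1mx mulmx1 mx2_tr.
  by rewrite subrr mul0r.
clearbody D; move: DZ trD trDZ; rewrite /mxtrace !big_ord_recl !big_ord0 !addr0.
have -> : lift ord0 ord0 = 1 :> 'I_2 by apply/val_inj.
move=> /matrixP DZ D2; rewrite !mulmx2E !mxE /= => D0.
have := (DZ 0 1, DZ 1 0); rewrite !mulmx2E !mxE /=.
rewrite !(mulr0, mul0r, mulr1, mul1r, mulrN, mulNr, addr0, add0r) => -[D01 D10].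
rewrite !(mulr0, mulr1, mulrN, addr0, add0r) in D0.
have two0 : 2 != 0 :> C by rewrite pnatr_eq0.
apply/matrixP => i j; rewrite [RHS]mxE; elim/ord2_ind: i; elim/ord2_ind: j => /=;
  apply: (mulfI two0).
- have -> : 2 * D 0 0 = (D 0 0 + D 1 1) + (D 0 0 - D 1 1) by ring.
  by rewrite D2 D0 addr0 mulr1.
- by rewrite mulr0 mulrDl mul1r -[X in X + _]opprK D01 addNr.
- by rewrite mulr0 mulrDl mul1r [X in X + _]D10 addNr.
- have -> : 2 * D 1 1 = (D 0 0 + D 1 1) - (D 0 0 - D 1 1) by ring.
  by rewrite D2 D0 subr0 mulr1.
Qed.

Lemma connected_lie_group_unital s b c (pe pg : R) U : ~~ (b && (s || c)) ->
  pe + pg = 1 -> connected_lie_group (@string_span R (lie_strings s b c)) U ->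
  unital (qubit_map U (ancilla_state pe pg)).
Proof.
move=> sbc pe1 LU; have rho1 := ancilla_state_tr pe1.
have comm z : (forall x, lie_strings s b c x -> ~~ string_anti x z) ->
    U *m adjmx U = 1%:M /\ U *m string_mx R z = string_mx R z *m U.
  move=> Lz; have [|X XL|UU Uz] := @connected_lie_group_sub _ _ (istring R z) _ _ _ LU.
  - exact: adjmx_string_span.
  - exact: (string_span_comm Lz XL).
  split=> //; move: Uz; rewrite /istring -(scalemxAr 'i%C) -(scalemxAl 'i%C).
  by apply: scalerI; rewrite eq_complex /= oner_eq0 andbF.
(* If [b] holds, neither [s] nor [c] does and sigma_3 (x) 1 is conserved; otherwise 1 (x) sigma_3
   is. *)
case: b sbc LU comm => sc LU comm.
  have [|UU Uz] := comm ((false, true), (false, false)).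
    by case: s c sc {LU comm} => [] [] // _ [[[] []] [[] []]].
  exact: unital_of_qubit_comm.
have [|UU Uz] := comm ((false, false), (false, true)).
  by case: s c {sc LU comm} => [] [] [[[] []] [[] []]].
apply: unital_of_ancilla_comm => //; rewrite ancilla_stateE.
have -> (k l : C) : 1%:M *t (k *: 1%:M + l *: sigma3 R) =
    k *: 1%:M + l *: string_mx R ((false, false), (false, true)).
  rewrite -tensmx11 -!tensmxZr; apply/matrixP => i j.
  by rewrite !mxE mulrDr.
by rewrite mulmxDr mulmxDl -!scalemxAr -!scalemxAl mulmx1 mul1mx Uz.
Qed.

Lemma string_mx_sqr x : string_mx R x *m string_mx R x = 1%:M.
Proof.
rewrite string_mul; case: x => [[[] []] [[] []]];
  by rewrite /bits_phase /string_mx /pauli_of /= mulr1 scale1r tensmx11.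
Qed.

Lemma scaler_half_sum (V : lmodType C) (A B : V) (u v : C) :
  u *: (2^-1 *: (A + B)) + v *: (2^-1 *: (A - B)) =
  ((u + v) / 2) *: A + ((u - v) / 2) *: B.
Proof.
rewrite 2!mulrDl mulNr !scalerDl scaleNr.
by rewrite !scalerA !scalerDr scalerN addrACA.
Qed.

(** A string squares to 1, so (1 + P)/2 and (1 - P)/2 are complementary idempotents, with phases [t]
    and [- t]. *)
Lemma expmx_istring x (t : R) :
  expmx (t%:C%C *: istring R x) = (cos t)%:C%C *: 1%:M + (sin t)%:C%C *: istring R x.
Proof.
pose P := string_mx R x; have PP : P *m P = 1%:M := string_mx_sqr x.
pose E (k : 'I_2) := (2^-1 : C) *: (if k == 0 then 1%:M + P else 1%:M - P).
have two0 : (2 : C) != 0 by rewrite pnatr_eq0.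
have EE i j : E i *m E j = if i == j then E i else 0.
  rewrite /E -scalemxAl -scalemxAr scalerA.
  have half (X : 'M[C]_(2 * 2)) : (2^-1 * 2^-1) *: (X + X) = 2^-1 *: X.
    have -> : X + X = (2 : C) *: X by rewrite scaler_nat mulr2n.
    by rewrite scalerA -mulrA mulVf // mulr1.
  elim/ord2_ind: i; elim/ord2_ind: j => /=;
    rewrite !(mulmxDl, mulmxDr, mulmx1, mul1mx, mulmxN, mulNmx) PP ?opprK.
  - by rewrite [P + _]addrC half.
  - by rewrite addrA subrK subrr scaler0.
  - by rewrite addrA addrK subrr scaler0.
  - by rewrite [- P + _]addrC half.
have E1 : \sum_i E i = 1%:M.
  rewrite !big_ord_recl big_ord0 addr0 /E /= -scalerDr addrACA subrr addr0.
  have -> : 1%:M + 1%:M = (2 : C) *: 1%:M :> 'M[C]_(2 * 2) by rewrite scaler_nat mulr2n.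
  by rewrite scalerA mulVf // scale1r.
have sumE (w : 'I_2 -> C) :
    \sum_k w k *: E k = ((w 0 + w 1) / 2) *: 1%:M + ((w 0 - w 1) / 2) *: P.
  rewrite !big_ord_recl big_ord0 addr0.
  have -> : lift ord0 ord0 = 1 :> 'I_2 by apply/val_inj.
  exact: scaler_half_sum.
pose t2 (k : 'I_2) := if k == 0 then t else - t.
have -> : t%:C%C *: istring R x = \sum_k ('i%C * (t2 k)%:C%C) *: E k.
  rewrite (sumE (fun k => 'i%C * (t2 k)%:C%C)) /t2 /= rmorphN mulrN subrr mul0r.
  rewrite scale0r add0r opprK /istring scalerA.
  by apply: (congr1 (fun u => u *: P)); field.
rewrite (expmx_sum_idem t2 EE E1) (sumE (fun k => expi (t2 k))) /t2 /= /expi cosN sinN.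
rewrite [(cos t +i* sin t)%C]complexE [(cos t +i* - sin t)%C]complexE /= rmorphN /=.
rewrite /istring scalerA -/P; congr (_ + _);
  [apply: (congr1 (fun u => u *: 1%:M)) | apply: (congr1 (fun u => u *: P))];
  by field.
Qed.

Lemma addrA_rev (V : nmodType) (a b c d : V) : a + b + c + d = d + c + b + a.
Proof. by rewrite addrC (addrC (a + b)) (addrC a) !addrA. Qed.

(* exp(i pi/4 sigma_1 sigma_1) exp(i pi/4 sigma_2 sigma_2) is the iSWAP gate:
   up to phases it exchanges the qubit and the ancilla. *)
Definition iswap : 'M[C]_(2 * 2) :=
  expmx ((pi / 4)%:C%C *: istring R ((true, false), (true, false))) *m
  expmx ((pi / 4)%:C%C *: istring R ((true, true), (true, true))).

Lemma iswapE : exists k : C, iswap = k *: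
  (1%:M + istring R ((true, false), (true, false)) +
   istring R ((true, true), (true, true)) + string_mx R ((false, true), (false, true))).
Proof.
pose h := (cos (pi / 4) : R)%:C%C; exists (h * h).
have sinh : (sin (pi / 4) : R)%:C%C = h.
  by rewrite /h -cosBpihalf (_ : pi / 4 - pi / 2 = - (pi / 4)) ?cosN //; field.
have prodE (A B : 'M[C]_(2 * 2)) : (h *: 1%:M + h *: A) *m (h *: 1%:M + h *: B) =
    (h * h) *: (1%:M + A + B + A *m B).
  rewrite -!scalerDr -(scalemxAl h) -(scalemxAr h) scalerA mulmxDl !mulmxDr.
  by rewrite !mulmx1 mul1mx addrA [1%:M + B + A]addrAC.
rewrite /iswap !expmx_istring sinh prodE.
apply: (congr1 (fun X => (h * h) *: (_ + X))).
(* The product of the two strings is i^2 (i sigma_3) (x) (i sigma_3), that is, sigma_3 (x)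
   sigma_3. *)
rewrite /istring -(scalemxAl 'i%C) -(scalemxAr 'i%C) string_mul !scalerA.
rewrite /bits_phase /bits_anti /bits_cyc /=.
have i2 : 'i%C * 'i%C = -1 :> C by rewrite -expr2 sqr_i.
by rewrite mulrA i2 mulN1r mulNr i2 opprK scale1r.
Qed.

(** By linearity it suffices that iSWAP carries sigma_3 on the ancilla to sigma_3 on the qubit. *)
Lemma iswap_exchange (rho : 'M[C]_2) (k l : C) : rho = k *: 1%:M + l *: sigma3 R ->
  iswap *m (1%:M *t rho) = (rho *t 1%:M) *m iswap.
Proof.
move=> rhoE; have [h ->] := iswapE.
have -> : 1%:M *t rho = k *: 1%:M + l *: string_mx R ((false, false), (false, true)).
  rewrite rhoE -tensmx11 -!tensmxZr; apply/matrixP => i j; by rewrite !mxE mulrDr.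
have -> : rho *t 1%:M = k *: 1%:M + l *: string_mx R ((false, true), (false, false)).
  rewrite rhoE -tensmx11 -!tensmxZl; apply/matrixP => i j; by rewrite !mxE mulrDl.
set W := _ + _ + _ + _; have WE := erefl W; rewrite {2}/W in WE; clearbody W.
rewrite -(scalemxAl h) -(scalemxAr h); apply: (congr1 (fun X => h *: X)).
rewrite mulmxDr mulmxDl -(scalemxAr k) -(scalemxAr l) -(scalemxAl k) -(scalemxAl l).
rewrite mulmx1 mul1mx; apply: (congr1 (fun X => _ + l *: X)).
have i2 : 'i%C * 'i%C = -1 :> C by rewrite -expr2 sqr_i.
have ii (X : 'M[C]_(2 * 2)) : 'i%C *: ('i%C *: X) = - X.
  by rewrite scalerA i2 scaleN1r.
have iNi (X : 'M[C]_(2 * 2)) : 'i%C *: ((- 'i%C) *: X) = X.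
  by rewrite scaleNr scalerN ii opprK.
have e1 : istring R ((true, false), (true, false)) *m string_mx R ((false, false), (false, true))
    = string_mx R ((true, false), (true, true)).
  by rewrite /istring -scalemxAl string_mul /bits_phase /= mul1r iNi.
have e2 : istring R ((true, true), (true, true)) *m string_mx R ((false, false), (false, true))
    = - string_mx R ((true, true), (true, false)).
  by rewrite /istring -scalemxAl string_mul /bits_phase /= mul1r ii.
have e3 : string_mx R ((false, true), (false, true)) *m string_mx R ((false, false), (false, true))
    = string_mx R ((false, true), (false, false)).
  by rewrite string_mul /bits_phase /= mul1r scale1r.
have f1 : string_mx R ((false, true), (false, false)) *m istring R ((true, false), (true, false))
    = - string_mx R ((true, true), (true, false)).
  by rewrite /istring -scalemxAr string_mul /bits_phase /= mulr1 ii.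
have f2 : string_mx R ((false, true), (false, false)) *m istring R ((true, true), (true, true))
    = string_mx R ((true, false), (true, true)).
  by rewrite /istring -scalemxAr string_mul /bits_phase /= mulr1 iNi.
have f3 : string_mx R ((false, true), (false, false)) *m string_mx R ((false, true), (false, true))
    = string_mx R ((false, false), (false, true)).
  by rewrite string_mul /bits_phase /= mul1r scale1r.
(* Both sides consist of the same four terms, in opposite orders. *)
rewrite WE !mulmxDl e1 e2 e3 mul1mx !mulmxDr f1 f2 f3 mulmx1.
exact: addrA_rev.
Qed.

(** The iSWAP gate sends 1 (x) rho to rho (x) 1, whose partial trace is 2 rho. Were this 1, the
    upper left entry would give 2 pe = 1, so pe = pg. *)
Lemma exists_non_unital (S : pred string) (pe pg : R) :
  S ((true, false), (true, false)) -> S ((true, true), (true, true)) ->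
  pe + pg = 1 -> pe <> pg ->
  exists U, connected_lie_group (@string_span R S) U /\
            ~ unital (qubit_map U (ancilla_state pe pg)).
Proof.
move=> S1 S2 pe1 peg.
have LU : connected_lie_group (@string_span R S) iswap.
  have [_ _ SZ] := @string_span_subspace R S.
  move=> H [[_ _ HM _] He]; have expH x : S x -> H (expmx ((pi / 4)%:C%C *: istring R x)).
    move=> Sx; apply: He; exists ((pi / 4)%:C%C *: istring R x) => //.
    exact/SZ/string_span_mem.
  by apply: HM; exact: expH.
exists iswap; split=> //.
have [|X _|UU _] := @connected_lie_group_sub _ _ 1%:M _ _ _ LU.
- exact: adjmx_string_span.
- by rewrite mulmx1 mul1mx.
rewrite /unital /qubit_map (iswap_exchange (ancilla_stateE pe pg)) -mulmxA UU mulmx1.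
rewrite ptraceB_tens mxtrace1 => /matrixP/(_ 0 0); rewrite !mxE /= => e.
have : (2 * pe)%:C%C = 1%:C%C :> C by rewrite rmorphM rmorph_nat.
by case=> e1; apply: peg; lra.
Qed.

End Purification.

(** * From flags back to Pauli matrices, the count of the cases, and the theorem *)

Lemma pauli_sigma3 (R : realType) a : pauli R a = sigma3 R <-> ~~ (bits_of a).1.
Proof.
case: a => [[|[|[|]]]] // p; split=> //; rewrite /pauli /= => /matrixP/(_ 0 0);
  by rewrite !mxE /= => /esym/eqP; rewrite oner_eq0.
Qed.

Lemma pauli_sigma12 (R : realType) a :
  pauli R a = sigma1 R \/ pauli R a = sigma2 R <-> (bits_of a).1.
Proof.
split=> [s12|].
  apply/negPn/negP => /(pauli_sigma3 R) s3; move: s12; rewrite s3.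
  by case=> /matrixP/(_ 0 0)/eqP; rewrite !mxE /= oner_eq0.
by case: a => [[|[|[|]]]] // p _; [left | right].
Qed.

Theorem mainTheorem5 (R : realType) :
  let L (s b c : 'I_3) :=
    dynamical_lie_algebra (pauli R s) (pauli R b) (pauli R c) in
  [/\ (forall s b c : 'I_3,
         direct_sum_decomposition (L s b c) (cartan_k (L s b c))
                                  (cartan_p (L s b c))),
      #|[pred x : 'I_3 * 'I_3 * 'I_3 |
          `[< cartan_dim (L x.1.1 x.1.2 x.2) 2 >]]| = 16%N,
      (forall s b c : 'I_3,
         cartan_dim (L s b c) 2 <->
         (pauli R b = sigma1 R \/ pauli R b = sigma2 R) /\
         (pauli R s, pauli R c) <> (sigma3 R, sigma3 R)),
      #|[pred x : 'I_3 * 'I_3 * 'I_3 |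
          `[< cartan_dim (L x.1.1 x.1.2 x.2) 1 >]]| = 11%N /\
      (forall s b c : 'I_3,
         ~ cartan_dim (L s b c) 2 -> cartan_dim (L s b c) 1)
    & (forall (s b c : 'I_3) (pe pg : R),
         0 <= pe -> 0 <= pg -> pe + pg = 1 -> pe <> pg ->
         (exists U, connected_lie_group (L s b c) U /\
                    ~ unital (qubit_map U (ancilla_state pe pg)))
         <-> cartan_dim (L s b c) 2)].
Proof.
move=> L.
(* A first bit is set exactly for sigma_1 and sigma_2, so [f] is the stated criterion as a
   computable boolean. *)
pose f (s b c : 'I_3) := (bits_of b).1 && ((bits_of s).1 || (bits_of c).1).
have LE s b c : L s b c = string_span (lie_strings (bits_of s).1 (bits_of b).1 (bits_of c).1).
  exact: dynamical_lie_algebraE.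
have dimL s b c : cartan_dim (L s b c) (if f s b c then 2 else 1).
  by rewrite LE; exact: cartan_dim_lie.
have dim2 s b c : cartan_dim (L s b c) 2 <-> f s b c.
  split=> [d2|fs]; last by have := dimL s b c; rewrite fs.
  by have := cartan_dim_inj d2 (dimL s b c); case: (f s b c).
have dim1 s b c : cartan_dim (L s b c) 1 <-> ~~ f s b c.
  split=> [d1|/negPf fs]; last by have := dimL s b c; rewrite fs.
  by have := cartan_dim_inj d1 (dimL s b c); case: (f s b c).
(* As a triple sum of booleans, each cardinal is evaluated by unfolding. *)
have card_triple (g : 'I_3 -> 'I_3 -> 'I_3 -> bool) :
    #|[pred x : 'I_3 * 'I_3 * 'I_3 | g x.1.1 x.1.2 x.2]| =
    (\sum_(s < 3) \sum_(b < 3) \sum_(c < 3) g s b c)%N.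
  rewrite -sum1_card big_mkcond /= !pair_bigA /=.
  by apply: eq_bigr => -[[s b] c] _; rewrite inE /=; case: (g s b c).
split.
- move=> s b c; rewrite LE cartan_kE cartan_pE; exact: string_span_direct_sum.
- rewrite (eq_card (B := [pred x : 'I_3 * 'I_3 * 'I_3 | f x.1.1 x.1.2 x.2])).
    by rewrite card_triple !big_ord_recl !big_ord0.
  by move=> x; rewrite !inE; apply/asboolP/idP => /dim2.
- move=> s b c; rewrite dim2 pauli_sigma12 /f; split=> [/andP[-> sc]|[-> sc]].
    split=> // -[/pauli_sigma3 s3 /pauli_sigma3 c3]; move: sc.
    by rewrite (negPf s3) (negPf c3).
  apply/negPn/negP; rewrite /= negb_or => /andP[s3 c3]; apply: sc.
  by congr pair; apply/pauli_sigma3.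
- split=> [|s b c]; last by move=> d2; apply/dim1/negP => /dim2.
  rewrite (eq_card (B := [pred x : 'I_3 * 'I_3 * 'I_3 | ~~ f x.1.1 x.1.2 x.2])).
    by rewrite (card_triple (fun s b c => ~~ f s b c)) !big_ord_recl !big_ord0.
  by move=> x; rewrite !inE; apply/asboolP/idP => /dim1.
move=> s b c pe pg _ _ pe1 peg; rewrite dim2 LE; split=> [[U [LU nU]]|fs].
  apply/negPn/negP => fs; apply: nU; exact: connected_lie_group_unital LU.
by apply: exists_non_unital => //; move: fs; rewrite /f;
  case: (bits_of s).1 (bits_of b).1 (bits_of c).1 => [] [] [].
Qed.
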